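(* Let $Q_n=[-\tfrac12,\tfrac12]^n$ and let $W_{Q_n}=\sup_{t\in Q_n}\langle U,t\rangle-\inf_{t\in Q_n}\langle U,t\rangle$, where $U$ is uniformly distributed on the unit sphere $\mathbb{S}^{n-1}\subset\mathbb{R}^n$. Then, as $n\to\infty$, $$W_{Q_n} - \sqrt{\frac{2n}{\pi}} \to \mathcal{N}\left(0, \frac{\pi-3}{\pi}\right)$$ in distribution.
   Context: $\mathcal{N}(0,s^2)$ denotes the centered normal distribution with variance $s^2$. *)

(* Defs.v *)
From HB Require Import structures.
From mathcomp Require Import all_boot all_order all_algebra.
From mathcomp Require Import all_classical all_reals all_analysis.
Set Implicit Arguments. Unset Strict Implicit. Unset Printing Implicit Defensive.
Import Order.TTheory GRing.Theory Num.Theory.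
Import numFieldNormedType.Exports.
Local Open Scope classical_set_scope.
Local Open Scope ring_scope.

Definition inner {R : realType} {n : nat} (u t : 'rV[R]_n) : R :=
  \sum_(i < n) u ord0 i * t ord0 i.

Definition cube (R : realType) (n : nat) : set 'rV[R]_n :=
  [set t | forall i : 'I_n, -(2^-1) <= t ord0 i <= 2^-1].

Definition width {R : realType} {n : nat} (K : set 'rV[R]_n) (u : 'rV[R]_n) : R :=
  sup [set inner u t | t in K] - inf [set inner u t | t in K].

Definition sqnorm {R : realType} {n : nat} (u : 'rV[R]_n) : R := inner u u.

Definition random_vector {d} {T : measurableType d} {R : realType} {n : nat}
  (U : T -> 'rV[R]_n) : Prop :=
  forall i : 'I_n, measurable_fun setT (fun w => U w ord0 i).

(* U is uniformly distributed on the unit sphere S^{n-1}: U lies on the sphere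
   and its law is the (unique) orthogonally invariant probability on it, i.e.
   P(U \in A) = P(U O \in A) for every orthogonal O and every open (hence every
   Borel) set A of R^n. *)
Definition uniform_on_sphere {d} {T : measurableType d} {R : realType} {n : nat}
  (P : probability T R) (U : T -> 'rV[R]_n) : Prop :=
  random_vector U /\
  (forall w, sqnorm (U w) = 1) /\
  (forall (O : 'M[R]_n), O *m O^T = 1%:M ->
     forall A : set 'rV[R]_n, open A ->
       P [set w | A (U w)] = P [set w | A (U w *m O)]).

(* Convergence in distribution of real random variables X n (defined on
   possibly different probability spaces P n) to a probability law mu on R:
   the distribution functions converge at every continuity point of the
   distribution function of mu. *)
Definition cvg_in_distribution {R : realType} (dn : nat -> measure_display)
  (Tn : forall n, measurableType (dn n)) (P : forall n, probability (Tn n) R)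
  (X : forall n, Tn n -> R) (mu : set R -> \bar R) : Prop :=
  forall x : R, mu [set x] = 0%E ->
    (fun n => P n [set w | X n w <= x]) @ \oo --> mu [set` `]-oo, x]].

(* Main.v *)
Require Import Defs.
From HB Require Import structures.
From mathcomp Require Import all_boot all_order all_algebra.
From mathcomp Require Import all_classical all_reals all_analysis.
From mathcomp Require Import measurable_realfun ring lra.
Import Order.TTheory GRing.Theory Num.Theory.
Import numFieldNormedType.Exports.
Local Open Scope classical_set_scope.
Local Open Scope ring_scope.
Set Implicit Arguments. Unset Strict Implicit. Unset Printing Implicit Defensive.

(**
The width of the cube in direction [u] is the l^1 norm of [u].  With
[Y = sqrt n U] and [m = sqrt (2 / pi)], the centred width is
[W = n^(-1/2) sum_i (|Y_i| - m)], and Stein's method applies directly to the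
uniform law, the only input being its invariance under rotations in a
coordinate plane: differentiating the mean of [Y_i q(Y_j) f(V)] along such
rotations and summing over [i <> j] gives an integration by parts formula.
Choosing [q] with [q' - y q = |y| - m] turns it into
[E (W f(W)) = E (T f'(W)) + O(n^(-1/2))], where [T] is a polynomial in empirical
averages of [|y|], [y q(y)] and [q(|y|)].  The same formula with [f] affine,
together with the solutions of Stein's equation for these three functions
(explicit in terms of the Mills ratio), gives a weak law of large numbers by
which [T] tends to [1 - 3 m^2 / 2 = (pi - 3) / pi].  Taking for [f] the Stein
solution of a piecewise linear approximation of a half-line indicator
concludes.
*)

(** * Differential calculus and bounded random variables *)

(** The coordinates of [U] are dependent, and their law is known only through its invariance: no
    Gaussian vector is at hand. The product [Y_i q(Y_j) f(V)] is chosen because its derivative along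
    the rotation in the plane [(i, j)] contains [Y_j q(Y_j) - Y_i^2 q'(Y_j)]; summing over [i],
    where the squares add up to exactly [n], produces [n (y q - q')], the Stein operator of the
    normal law. Taking [q] odd makes every term depend on [|Y|] alone, so [q] need only be
    prescribed on the half-line, with [q(0) = 0]. Together with a bounded derivative, this condition
    fixes the constant subtracted in Stein's equation.

    The same identity on squares makes most error bounds deterministic: an empirical sum of a
    function of at most quadratic growth is surely [O(n)]. Variances, obtained from affine [f], are
    the only probabilistic estimate. *)

Definition continuously_differentiable {R : realType} (f df : R -> R) : Prop :=
  (forall x : R, is_derive x 1 f (df x)) /\ continuous df.

Lemma is_derive1_continuous {R : realType} (f df : R -> R) :
  (forall x : R, is_derive x 1 f (df x)) -> continuous f.
Proof.
move=> fdf x; apply: differentiable_continuous.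
by apply/derivable1_diffP; exact: ex_derive.
Qed.

(** Differentiability is asked on [[a, b]] only, since some functions below involve [x^-1]. *)
Lemma MVT_le {R : realType} {f df : R -> R} {a b : R} : a <= b ->
  (forall x, a <= x <= b -> is_derive x 1 f (df x)) ->
  exists2 c, a <= c <= b & f b - f a = df c * (b - a).
Proof.
move=> ab fdf; have [||c cab ->] := @MVT_segment R f df a b ab.
- by move=> x /itvP xab; apply: fdf; rewrite !xab.
- apply: derivable_within_continuous => x /itvP xab.
  by have := fdf x; rewrite !xab => /(_ isT) ?; exact: ex_derive.
by exists c => //; rewrite !(itvP cab).
Qed.

Lemma MVT_between {R : realType} {f df : R -> R} :
  (forall x : R, is_derive x 1 f (df x)) -> forall a b,
  exists2 c, Num.min a b <= c <= Num.max a b & f b - f a = df c * (b - a).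
Proof.
move=> fdf a b; have [ab|ba] := leP a b.
  by have [c ? ?] := MVT_le ab (fun x _ => fdf x); exists c.
have [c ? e] := MVT_le (ltW ba) (fun x _ => fdf x); exists c => //.
by rewrite -(opprB (f a)) e -mulrN opprB.
Qed.

Section continuously_differentiable_functions.
Context {R : realType}.
Implicit Types f df g dg : R -> R.

Lemma C1_continuous f df : continuously_differentiable f df -> continuous f.
Proof. by move=> [fd _]; exact: is_derive1_continuous fd. Qed.

Lemma eq_C1 f df g dg : continuously_differentiable f df ->
  f =1 g -> df =1 dg -> continuously_differentiable g dg.
Proof. by move=> + /funext <- /funext <-. Qed.

Lemma C1_cst (a : R) : continuously_differentiable (fun=> a) (fun=> 0).
Proof. by split => [x|x]; [exact: is_derive_cst|exact: cvg_cst]. Qed.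

Lemma C1_id : continuously_differentiable (fun x : R => x) (fun=> 1).
Proof. by split => [x|x]; [exact: is_derive_id|exact: cvg_cst]. Qed.

Lemma C1D f df g dg :
  continuously_differentiable f df -> continuously_differentiable g dg ->
  continuously_differentiable (fun x => f x + g x) (fun x => df x + dg x).
Proof.
move=> [fd cdf] [gd cdg]; split=> x; first exact: is_deriveD (fd x) (gd x).
exact: cvgD (cdf x) (cdg x).
Qed.

Lemma C1M f df g dg :
  continuously_differentiable f df -> continuously_differentiable g dg ->
  continuously_differentiable (fun x => f x * g x)
    (fun x => df x * g x + f x * dg x).
Proof.
move=> Cf Cg; have [[fd cdf] [gd cdg]] := (Cf, Cg); split=> x.
  apply: (is_derive_eq (is_deriveM (fd x) (gd x))).
  by rewrite addrC [g x *: _]mulrC.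
have [cf cg] := (C1_continuous Cf, C1_continuous Cg).
exact: cvgD (cvgM (cdf x) (cg x)) (cvgM (cf x) (cdg x)).
Qed.

Lemma C1_comp f df g dg :
  continuously_differentiable f df -> continuously_differentiable g dg ->
  continuously_differentiable (fun x => f (g x)) (fun x => df (g x) * dg x).
Proof.
move=> Cf Cg; have [[fd cdf] [gd cdg]] := (Cf, Cg); split=> x.
  exact: is_derive1_comp (fd (g x)) (gd x).
have cg := C1_continuous Cg.
by apply: cvgM (cdg x); exact: cvg_comp (cg x) (cdf _).
Qed.

Lemma C1Z (a : R) f df : continuously_differentiable f df ->
  continuously_differentiable (fun x => a * f x) (fun x => a * df x).
Proof.
by move=> Cf; apply: (eq_C1 (C1M (C1_cst a) Cf)) => // x; rewrite mul0r add0r.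
Qed.

Lemma C1B f df g dg :
  continuously_differentiable f df -> continuously_differentiable g dg ->
  continuously_differentiable (fun x => f x - g x) (fun x => df x - dg x).
Proof.
by move=> Cf Cg; apply: (eq_C1 (C1D Cf (C1Z (-1) Cg))) => x; rewrite mulN1r.
Qed.

End continuously_differentiable_functions.

Lemma continuous_bounded_ball {R : realType} (g : R -> R) (C : R) :
  continuous g -> exists D, forall x, `|x| <= C -> `|g x| <= D.
Proof.
move=> cg; have [C0|C0] := ltP C 0.
  by exists 0 => x xC; have := le_lt_trans xC C0; rewrite normr_lt0.
have [||c _ cP] := @EVT_max R (fun x => `|g x|) (- C) C.
- by rewrite (le_trans _ C0)// oppr_le0.
- apply: continuous_subspaceT => x; apply: cvg_norm; exact: cg.
by exists `|g c| => x; rewrite ler_norml => xC; apply: cP; rewrite in_itv.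
Qed.

Section bounded_random_variables.
Context {d : measure_display} {T : measurableType d} {R : realType}.
Variable P : probability T R.
Implicit Types X Y : T -> R.

(** The coordinates of [sqrt n U] are bounded by [sqrt n], so every random variable below is
    bounded; closure under algebra and continuous maps then settles all integrability conditions. *)
Definition bounded_rv (X : T -> R) : Prop :=
  measurable_fun setT X /\ exists C, forall w, `|X w| <= C.

Lemma bounded_rv_cst (a : R) : bounded_rv (fun=> a).
Proof. by split => //; exists `|a|. Qed.

Lemma bounded_rvD X Y : bounded_rv X -> bounded_rv Y ->
  bounded_rv (fun w => X w + Y w).
Proof.
move=> [mX [C XC]] [mY [D YD]]; split; first exact: measurable_funD.
by exists (C + D) => w; rewrite (le_trans (ler_normD _ _))// lerD.
Qed.

Lemma bounded_rvM X Y : bounded_rv X -> bounded_rv Y ->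
  bounded_rv (fun w => X w * Y w).
Proof.
move=> [mX [C XC]] [mY [D YD]]; split; first exact: measurable_funM.
by exists (C * D) => w; rewrite normrM ler_pM.
Qed.

Lemma bounded_rvZ a X : bounded_rv X -> bounded_rv (fun w => a * X w).
Proof. by move=> bX; apply: bounded_rvM => //; exact: bounded_rv_cst. Qed.

Lemma bounded_rv_comp (g : R -> R) X : continuous g -> bounded_rv X ->
  bounded_rv (fun w => g (X w)).
Proof.
move=> cg [mX [C XC]]; split.
  by apply: (measurableT_comp _ mX); exact: continuous_measurable_fun.
by have [D gD] := continuous_bounded_ball C cg; exists D => w; exact: gD.
Qed.

Lemma bounded_rvN X : bounded_rv X -> bounded_rv (fun w => - X w).
Proof. by apply: bounded_rv_comp; exact: opp_continuous. Qed.

Lemma bounded_rvB X Y : bounded_rv X -> bounded_rv Y ->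
  bounded_rv (fun w => X w - Y w).
Proof. by move=> ? ?; apply: bounded_rvD => //; exact: bounded_rvN. Qed.

Lemma bounded_rv_norm X : bounded_rv X -> bounded_rv (fun w => `|X w|).
Proof. by apply: bounded_rv_comp; exact: norm_continuous. Qed.

Lemma bounded_rvX X k : bounded_rv X -> bounded_rv (fun w => X w ^+ k).
Proof. exact: (@bounded_rv_comp (fun x => x ^+ k) _ (@exprn_continuous R k)). Qed.

Lemma bounded_rv_sum (I : Type) (r : seq I) (Q : pred I) (F : I -> T -> R) :
  (forall i, Q i -> bounded_rv (F i)) ->
  bounded_rv (fun w => \sum_(i <- r | Q i) F i w).
Proof.
move=> bF; elim: r => [|i r IH].
  by under eq_fun do rewrite big_nil; exact: bounded_rv_cst.
under eq_fun do rewrite big_cons.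
by case: (boolP (Q i)) => // /bF ?; exact: bounded_rvD.
Qed.

Lemma bounded_rv_integrable X : bounded_rv X -> P.-integrable setT (EFin \o X).
Proof.
move=> [mX [C XC]]; apply: (@le_integrable _ _ _ _ _ _ _ (EFin \o cst C)) => //.
- exact/measurable_EFinP.
- by move=> w _; rewrite /= lee_fin (le_trans (XC w))// ler_norm.
- exact: finite_measure_integrable_cst.
Qed.

Definition mean (X : T -> R) : R := \int[P]_w X w.

Lemma eq_mean X Y : X =1 Y -> mean X = mean Y.
Proof. by move=> XY; apply: eq_Rintegral => w _. Qed.

Lemma mean_cst a : mean (fun=> a) = a.
Proof. by rewrite /mean Rintegral_cst//= [X in fine X](@probability_setT _ _ _ P) mulr1. Qed.

Lemma meanD X Y : bounded_rv X -> bounded_rv Y ->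
  mean (fun w => X w + Y w) = mean X + mean Y.
Proof. by move=> bX bY; apply: RintegralD => //; exact: bounded_rv_integrable. Qed.

Lemma meanB X Y : bounded_rv X -> bounded_rv Y ->
  mean (fun w => X w - Y w) = mean X - mean Y.
Proof. by move=> bX bY; apply: RintegralB => //; exact: bounded_rv_integrable. Qed.

Lemma meanZ a X : bounded_rv X -> mean (fun w => a * X w) = a * mean X.
Proof. by move=> bX; apply: RintegralZl => //; exact: bounded_rv_integrable. Qed.

Lemma le_mean X Y : bounded_rv X -> bounded_rv Y ->
  (forall w, X w <= Y w) -> mean X <= mean Y.
Proof.
by move=> bX bY XY; apply: le_Rintegral => //; exact: bounded_rv_integrable.
Qed.

Lemma le_norm_mean X Y : bounded_rv X -> bounded_rv Y ->
  (forall w, `|X w| <= Y w) -> `|mean X| <= mean Y.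
Proof.
move=> bX bY XY; apply: le_trans (le_mean (bounded_rv_norm bX) bY XY).
by apply: le_normr_Rintegral => //; exact: bounded_rv_integrable.
Qed.

Lemma mean_sum (I : Type) (r : seq I) (Q : pred I) (F : I -> T -> R) :
  (forall i, Q i -> bounded_rv (F i)) ->
  mean (fun w => \sum_(i <- r | Q i) F i w) = \sum_(i <- r | Q i) mean (F i).
Proof.
move=> bF; elim: r => [|i r IH].
  by rewrite big_nil; under eq_mean do rewrite big_nil; exact: mean_cst.
under eq_mean do rewrite big_cons; rewrite big_cons.
by case: (boolP (Q i)) => // Qi; rewrite meanD ?IH//; [exact: bF|exact: bounded_rv_sum].
Qed.

(* Boundedness makes the layer-cake formula available after a translation. *)
Lemma eq_mean_ccdf X Y : bounded_rv X -> bounded_rv Y ->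
  (forall r, P [set w | r < X w] = P [set w | r < Y w]) -> mean X = mean Y.
Proof.
move=> bX bY XY; have [[mX [C XC]] [mY [D YD]]] := (bX, bY).
pose A := Num.max C D.
have XA w : 0 <= X w + A.
  by rewrite -lerBlDr sub0r lerNl (le_trans (ler_norm _))// normrN le_max XC.
have YA w : 0 <= Y w + A.
  by rewrite -lerBlDr sub0r lerNl (le_trans (ler_norm _))// normrN le_max YD orbT.
have mXA : measurable_fun setT (fun w => X w + A) by exact: measurable_funD.
have mYA : measurable_fun setT (fun w => Y w + A) by exact: measurable_funD.
have := @ge0_expectation_ccdf _ _ _ P (mfun_Sub (mem_set mXA)) XA.
have := @ge0_expectation_ccdf _ _ _ P (mfun_Sub (mem_set mYA)) YA.
have -> : ccdf (mfun_Sub (mem_set mXA) : {RV P >-> R}) =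
          ccdf (mfun_Sub (mem_set mYA) : {RV P >-> R}).
  apply/funext => r; rewrite /ccdf /distribution /pushforward.
  rewrite (_ : _ @^-1` _ = [set w | r - A < X w]); last first.
    by apply/seteqP; split => w /=; rewrite in_itv/= andbT ltrBlDr.
  rewrite XY; congr (P _).
  by apply/seteqP; split => w /=; rewrite in_itv/= andbT ltrBlDr.
move=> <-; rewrite !expectation_def/= => /(congr1 fine).
have e Z : bounded_rv Z -> fine (\int[P]_w (Z w + A)%:E) = mean Z + A.
  by move=> bZ; rewrite -[RHS](congr1 _ (mean_cst A)) -meanD//; exact: bounded_rv_cst.
by rewrite !e// => /addIr.
Qed.

End bounded_random_variables.

(** A chain rule in which both endpoints move and neither need equal [l]. This is why [dg] has to be
    continuous: the mean value theorem gives [dg] at a point squeezed between [a k] and [b k]. *)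
Lemma cvg_difference_quotient_comp {R : realType} (g dg : R -> R)
    (a b t : nat -> R) (l v : R) :
  continuously_differentiable g dg -> a @ \oo --> l -> b @ \oo --> l ->
  (fun k => (b k - a k) / t k) @ \oo --> v ->
  (fun k => (g (b k) - g (a k)) / t k) @ \oo --> dg l * v.
Proof.
move=> [gdg cdg] al bl abv.
have /choice[c cP] k : exists c, Num.min (a k) (b k) <= c <= Num.max (a k) (b k) /\
    g (b k) - g (a k) = dg c * (b k - a k).
  by have [c ? ?] := MVT_between gdg (a k) (b k); exists c.
have cl : c @ \oo --> l.
  apply/cvgrPdist_lt => e e0; near=> k.
  have : `|l - a k| < e by near: k; exact: cvgr_dist_lt.
  have : `|l - b k| < e by near: k; exact: cvgr_dist_lt.
  have [/andP[]] := cP k; rewrite ge_min le_max !ltr_norml.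
  by move=> /orP[] ? /orP[] ? _ /andP[? ?] /andP[? ?]; lra.
have -> : (fun k => (g (b k) - g (a k)) / t k) =
          (fun k => dg (c k) * ((b k - a k) / t k)).
  by apply/funext => k; rewrite (cP k).2 mulrA.
apply: cvgM => //; apply: (cvg_comp _ _ cl); exact: cdg.
Unshelve. all: by end_near. Qed.

(** * Pointwise convergence under a uniform bound *)

Section dominated_convergence_of_random_variables.
Context {d : measure_display} {T : measurableType d} {R : realType}.
Variable P : probability T R.
Implicit Types (X Y : nat -> T -> R) (x y : T -> R).

(** These are the hypotheses of dominated convergence with a constant dominating function, in a form
    stable under sums, products and continuous maps. Convergence holds at every point, so null sets
    never appear. *)
Definition bounded_cvg (X : nat -> T -> R) (x : T -> R) : Prop :=
  [/\ forall k, measurable_fun setT (X k),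
      exists C, forall k w, `|X k w| <= C &
      forall w, X ^~ w @ \oo --> x w].

Lemma bounded_cvg_rv X x k : bounded_cvg X x -> bounded_rv (X k).
Proof. by move=> [mX [C XC] _]; split => //; exists C. Qed.

Lemma bounded_cvg_cst x : bounded_rv x -> bounded_cvg (fun=> x) x.
Proof. by move=> [mx [C xC]]; split => //; [exists C | move=> w; exact: cvg_cst]. Qed.

Lemma bounded_cvg_seq (a : nat -> R) (l C : R) : (forall k, `|a k| <= C) ->
  a @ \oo --> l -> bounded_cvg (fun k _ => a k) (fun=> l).
Proof. by move=> aC al; split => //; exists C. Qed.

Lemma bounded_cvgD X x Y y : bounded_cvg X x -> bounded_cvg Y y ->
  bounded_cvg (fun k w => X k w + Y k w) (fun w => x w + y w).
Proof.
move=> [mX [C XC] Xx] [mY [D YD] Yy]; split.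
- by move=> k; exact: measurable_funD.
- by exists (C + D) => k w; rewrite (le_trans (ler_normD _ _))// lerD.
- by move=> w; exact: cvgD (Xx w) (Yy w).
Qed.

Lemma bounded_cvgM X x Y y : bounded_cvg X x -> bounded_cvg Y y ->
  bounded_cvg (fun k w => X k w * Y k w) (fun w => x w * y w).
Proof.
move=> [mX [C XC] Xx] [mY [D YD] Yy]; split.
- by move=> k; exact: measurable_funM.
- by exists (C * D) => k w; rewrite normrM ler_pM.
- by move=> w; exact: cvgM (Xx w) (Yy w).
Qed.

Lemma bounded_cvg_comp (g : R -> R) X x : continuous g -> bounded_cvg X x ->
  bounded_cvg (fun k w => g (X k w)) (fun w => g (x w)).
Proof.
move=> cg bX; have [mX [C XC] Xx] := bX; split.
- by move=> k; have [] := bounded_rv_comp cg (bounded_cvg_rv k bX).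
- have [D gD] := continuous_bounded_ball C cg.
  by exists D => k w; exact: gD.
- by move=> w; apply: (cvg_comp _ _ (Xx w)); exact: cg.
Qed.

Lemma bounded_cvgN X x : bounded_cvg X x ->
  bounded_cvg (fun k w => - X k w) (fun w => - x w).
Proof. by apply: bounded_cvg_comp; exact: opp_continuous. Qed.

Lemma bounded_cvgB X x Y y : bounded_cvg X x -> bounded_cvg Y y ->
  bounded_cvg (fun k w => X k w - Y k w) (fun w => x w - y w).
Proof. by move=> ? ?; apply: bounded_cvgD => //; exact: bounded_cvgN. Qed.

Lemma bounded_cvg_norm X x : bounded_cvg X x ->
  bounded_cvg (fun k w => `|X k w|) (fun w => `|x w|).
Proof. by apply: bounded_cvg_comp; exact: norm_continuous. Qed.

Lemma bounded_cvg_difference_quotient (g dg : R -> R) A B (t : nat -> R) l v :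
  continuously_differentiable g dg -> bounded_cvg A l -> bounded_cvg B l ->
  bounded_cvg (fun k w => (B k w - A k w) / t k) v ->
  bounded_cvg (fun k w => (g (B k w) - g (A k w)) / t k)
              (fun w => dg (l w) * v w).
Proof.
move=> [gdg cdg] bA bB bAB.
have [[mA [C AC] Al] [mB [D BD] Bl]] := (bA, bB).
have [_ [E ABE] ABv] := bAB.
have cg := is_derive1_continuous gdg; split.
- move=> k; apply: measurable_funM => //.
  by apply: measurable_funB; apply: (measurableT_comp _ (_ : measurable_fun setT _)) => //;
    exact: continuous_measurable_fun.
- have [F dgF] := continuous_bounded_ball (Num.max C D) cdg.
  exists (F * E) => k w.
  have [c /andP[c1 c2] ->] := MVT_between gdg (A k w) (B k w).
  rewrite -mulrA normrM ler_pM//; apply: dgF; rewrite ler_norml.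
  move: (AC k w) (BD k w); rewrite !ler_norml => /andP[a1 a2] /andP[b1 b2].
  move: c1 c2; rewrite ge_min le_max => c1 c2.
  apply/andP; split.
  + rewrite lerNl le_max; case/orP: c1 => h; apply/orP; [left|right]; lra.
  + rewrite le_max; case/orP: c2 => h; apply/orP; [left|right]; lra.
- by move=> w; apply: cvg_difference_quotient_comp (ABv w).
Qed.

Lemma bounded_cvg_mean X x : bounded_cvg X x ->
  bounded_rv x /\ (fun k => mean P (X k)) @ \oo --> mean P x.
Proof.
move=> bX; have [mX [C XC] Xx] := bX.
have bx : bounded_rv x.
  split; first exact: (measurable_fun_cvg mX (fun w _ => Xx w)).
  exists C => w; apply/ler_addgt0Pr => e e0; near \oo => k.
  have : `|x w - X k w| < e by near: k; exact: cvgr_dist_lt.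
  by have := XC k w; rewrite !ler_norml ltr_norml => /andP[? ?] /andP[? ?]; lra.
split => //; apply: fine_cvg.
rewrite fineK; last by apply: integrable_fin_num => //; exact: bounded_rv_integrable.
apply: (@dominated_cvg _ _ _ P setT measurableT (fun k w => (X k w)%:E)
   (fun w => (x w)%:E) (fun=> C%:E)) => //.
- by move=> k; apply/measurable_EFinP.
- by move=> w _; apply: cvg_EFin; [exact: nearW|exact: Xx].
- exact: finite_measure_integrable_cst.
- by move=> k w _; rewrite lee_fin.
Unshelve. all: by end_near. Qed.

End dominated_convergence_of_random_variables.

(** * Infinitesimal rotations *)

Section givens_rotation.
Context {R : realType} {n : nat}.
Implicit Types (i j l : 'I_n) (u : 'rV[R]_n).

(** The rotation with cosine [c] and sine [s] in the plane of coordinates [i] and [j], written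
    [1 + (c - 1) A + s B] with [A] the projection onto that plane and [B] a quarter turn in it.
    Orthogonality then reduces to [A A = A], [A B = B A = B] and [B B = - A]. *)
Definition givens i j (c s : R) : 'M[R]_n :=
  1%:M + (c - 1) *: (delta_mx i i + delta_mx j j)
       + s *: (delta_mx j i - delta_mx i j).

Lemma givens_orthogonal i j c s : i != j -> c ^+ 2 + s ^+ 2 = 1 ->
  givens i j c s *m (givens i j c s)^T = 1%:M.
Proof.
move=> ij cs; rewrite /givens.
set A := delta_mx i i + delta_mx j j; set B := delta_mx j i - delta_mx i j.
have ji : j == i = false by rewrite eq_sym (negbTE ij).
have AA : A *m A = A.
  rewrite /A mulmxDl !mulmxDr !mul_delta_mx_cond !eqxx (negbTE ij) ji.
  by rewrite !mulr1n !mulr0n addr0 add0r.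
have AB : A *m B = B.
  rewrite /A /B mulmxDl !mulmxBr !mul_delta_mx_cond !eqxx (negbTE ij) ji.
  by rewrite !mulr1n !mulr0n sub0r subr0 addrC.
have BA : B *m A = B.
  rewrite /A /B mulmxBl !mulmxDr !mul_delta_mx_cond !eqxx (negbTE ij) ji.
  by rewrite !mulr1n !mulr0n addr0 add0r.
have BB : B *m B = - A.
  rewrite /A /B mulmxBl !mulmxBr !mul_delta_mx_cond !eqxx (negbTE ij) ji.
  by rewrite !mulr1n !mulr0n sub0r subr0 -opprD addrC.
have tA : A^T = A by rewrite /A linearD/= !trmx_delta.
have tB : B^T = - B by rewrite /B linearB/= !trmx_delta opprB.
have -> : (1%:M + (c - 1) *: A + s *: B)^T = 1%:M + (c - 1) *: A - s *: B.
  by rewrite 2!linearD 2!linearZ /= tA tB trmx1 scalerN.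
rewrite mulmxDl !mulmxDr !mulmxDl !mul1mx !mulmx1.
rewrite !mulmxN -!scalemxAl -!scalemxAr AA AB BA BB.
rewrite ?scalerN ?opprK !scalerA.
have {}cs : s * s = 1 - c * c by rewrite -cs !expr2 addrC addKr.
rewrite cs (mulrC s (c - 1)).
apply/matrixP => a b; rewrite !mxE; ring.
Qed.

Lemma mulmx_delta_row u i j l :
  (u *m delta_mx i j) ord0 l = u ord0 i * (l == j)%:R.
Proof.
rewrite mxE (bigD1 i)//= big1 ?addr0; last first.
  by move=> k /negbTE ki; rewrite mxE ki mulr0.
by rewrite mxE eqxx.
Qed.

Lemma givensE i j c s u l : i != j -> (u *m givens i j c s) ord0 l =
  if l == i then c * u ord0 i + s * u ord0 j
  else if l == j then c * u ord0 j - s * u ord0 i else u ord0 l.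
Proof.
move=> ij; have -> : u *m givens i j c s =
    u + (c - 1) *: (u *m delta_mx i i + u *m delta_mx j j)
      + s *: (u *m delta_mx j i - u *m delta_mx i j).
  by rewrite /givens !mulmxDr mulmx1 -!scalemxAr mulmxDr mulmxBr.
have E (A B C D : 'rV[R]_n) a b :
    (u + a *: (A + B) + b *: (C - D)) ord0 l =
    u ord0 l + a * (A ord0 l + B ord0 l) + b * (C ord0 l - D ord0 l).
  by rewrite !mxE.
rewrite E !mulmx_delta_row.
have [->|li] := eqVneq l i; first by rewrite (negbTE ij) /=; ring.
by have [->|lj] := eqVneq l j; rewrite /=; ring.
Qed.
End givens_rotation.

Section small_rotations.
Context {R : realType}.

(** The angles tending to zero are given by their sine, the cosine being recovered by a square root;
    only [c ^+ 2 + s ^+ 2 = 1] and the two limits matter. *)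
Definition rot_sin (k : nat) : R := k.+1%:R^-1.
Definition rot_cos (k : nat) : R := Num.sqrt (1 - rot_sin k ^+ 2).

Lemma rot_sin_gt0 k : 0 < rot_sin k.
Proof. by rewrite /rot_sin invr_gt0. Qed.

Lemma rot_sin_le1 k : rot_sin k <= 1.
Proof. by rewrite /rot_sin invf_le1// ler1n. Qed.

Lemma rot_cos_sin k : rot_cos k ^+ 2 + rot_sin k ^+ 2 = 1.
Proof.
rewrite sqr_sqrtr ?subrK// subr_ge0 exprn_ile1//; last exact: rot_sin_le1.
exact/ltW/rot_sin_gt0.
Qed.

Lemma cvg_rot_sin : rot_sin @ \oo --> (0 : R).
Proof. exact: cvg_harmonic. Qed.

Lemma cvg_rot_cos : rot_cos @ \oo --> (1 : R).
Proof.
have h : (fun k => 1 - rot_sin k ^+ 2) @ \oo --> (1 - 0 ^+ 2 : R).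
  apply: cvgB; first exact: cvg_cst.
  exact: (cvg_comp _ _ cvg_rot_sin (@exprn_continuous R 2 0)).
have := cvg_comp _ _ h (@sqrt_continuous R _).
by rewrite expr0n subr0 sqrtr1.
Qed.

Lemma norm_rot_cos_le1 k : `|rot_cos k| <= 1.
Proof.
rewrite ger0_norm ?sqrtr_ge0// -[leRHS]sqrtr1 ler_wsqrtr//.
by rewrite lerBlDr lerDl sqr_ge0.
Qed.

Lemma norm_rot_sin_le1 k : `|rot_sin k| <= 1.
Proof. by rewrite gtr0_norm ?rot_sin_gt0// rot_sin_le1. Qed.

End small_rotations.

(** * Symmetric difference quotients along small rotations *)

Section symmetric_quotients.
Context {d : measure_display} {T : measurableType d} {R : realType}.
Implicit Types y z : T -> R.

Definition turn y z k w := rot_cos k * y w + rot_sin k * z w.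

Lemma turnN y z k w :
  turn y (fun w => - z w) k w = rot_cos k * y w - rot_sin k * z w.
Proof. by rewrite /turn mulrN. Qed.

Lemma bounded_cvg_turn y z : bounded_rv y -> bounded_rv z ->
  bounded_cvg (turn y z) y.
Proof.
move=> by_ bz.
have bc := bounded_cvg_seq (T := T) (@norm_rot_cos_le1 R) cvg_rot_cos.
have bs := bounded_cvg_seq (T := T) (@norm_rot_sin_le1 R) cvg_rot_sin.
have := bounded_cvgD (bounded_cvgM bc (bounded_cvg_cst by_))
                     (bounded_cvgM bs (bounded_cvg_cst bz)).
by congr bounded_cvg; apply/funext => w; rewrite mul1r mul0r addr0.
Qed.

(* Symmetric quotients have a limit even at the kink of [|.|], so no argument
   that [y <> 0] almost surely is needed. *)
Definition symq (A B : nat -> T -> R) k w := (B k w - A k w) / (2 * rot_sin k).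

Lemma bounded_cvg_symq_turn y z : bounded_rv y -> bounded_rv z ->
  bounded_cvg (symq (turn y (fun w => - z w)) (turn y z)) z.
Proof.
move=> by_ bz.
suff -> : symq (turn y (fun w => - z w)) (turn y z) = fun=> z.
  exact: bounded_cvg_cst.
apply/funext => k; apply/funext => w; rewrite /symq turnN /turn.
by field; rewrite gt_eqF ?rot_sin_gt0.
Qed.

(* At [y = 0] the quotient vanishes identically, which matches [Num.sg 0 = 0]. *)
Lemma bounded_cvg_symq_norm y z : bounded_rv y -> bounded_rv z ->
  bounded_cvg (symq (fun k w => `|turn y (fun w => - z w) k w|)
                    (fun k w => `|turn y z k w|))
              (fun w => Num.sg (y w) * z w).
Proof.
move=> by_ bz; have bNz := bounded_rvN bz.
have [bp bm] := (bounded_cvg_turn by_ bz, bounded_cvg_turn by_ bNz).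
split.
- move=> k; apply: measurable_funM => //.
  have [mp _] := bounded_rv_norm (bounded_cvg_rv k bp).
  have [mm _] := bounded_rv_norm (bounded_cvg_rv k bm).
  exact: measurable_funB.
- have [_ [C zC]] := bz; exists C => k w; apply: le_trans (zC w).
  rewrite /symq normrM normfV [`|2 * _|]gtr0_norm ?mulr_gt0 ?rot_sin_gt0//.
  rewrite ler_pdivrMr ?mulr_gt0 ?rot_sin_gt0//.
  rewrite (le_trans (ler_dist_dist _ _))// turnN /turn.
  rewrite (_ : _ - _ = 2 * rot_sin k * z w); last by ring.
  by rewrite normrM mulrC [`|2 * _|]gtr0_norm ?mulr_gt0 ?rot_sin_gt0.
- move=> w; have [y0|y0] := eqVneq (y w) 0.
    rewrite y0 sgr0 mul0r; apply: cvg_near_cst; apply: nearW => k.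
    by rewrite /symq turnN /turn y0 mulr0 add0r sub0r normrN subrr mul0r.
  have h : (fun k => `|rot_sin k * z w|) @ \oo --> (0 : R).
    have : (fun k => `|rot_sin k * z w|) @ \oo --> `|0 * z w|.
      by apply: cvg_norm; apply: cvgM; [exact: cvg_rot_sin|exact: cvg_cst].
    by rewrite mul0r normr0.
  (* As soon as [|s z| < |y| / 2 < c |y|], both turned values have the sign of [y], and the quotient
     equals [Num.sg y * z] exactly. *)
  apply: cvg_near_cst; near=> k.
  have s0 := @rot_sin_gt0 R k.
  have c2 : 2^-1 < @rot_cos R k.
    by near: k; apply: (cvgr_gt _ cvg_rot_cos); lra.
  have sz : `|rot_sin k * z w| < 2^-1 * `|y w|.
    near: k; apply: (cvgr_lt _ h).
    by rewrite mulr_gt0 ?normr_gt0.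
  rewrite /symq turnN /turn.
  have [yp|yn|/eqP] := ltgtP (y w) 0; last by rewrite (negbTE y0).
  + rewrite (ltr0_sg yp) (ltr0_norm yp) in sz *.
    have : rot_cos k * y w < 2^-1 * y w by rewrite ltr_nM2r.
    move: sz; rewrite ltr_norml => /andP[h1 h2] h3.
    rewrite ltr0_norm; last by lra.
    rewrite ltr0_norm; last by lra.
    by field; rewrite gt_eqF.
  + rewrite (gtr0_sg yn) (gtr0_norm yn) in sz *.
    have : 2^-1 * y w < rot_cos k * y w by rewrite ltr_pM2r.
    move: sz; rewrite ltr_norml => /andP[h1 h2] h3.
    rewrite gtr0_norm; last by lra.
    rewrite gtr0_norm; last by lra.
    by field; rewrite gt_eqF.
Unshelve. all: by end_near. Qed.

(** For [g 0 = 0] this is [sg y * g |y|], written as [g] of the positive part minus [g] of the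
    negative part, so that only the quotients of [|.|] and composition with a C1 function are needed
    to differentiate it. *)
Definition odd_extension (g : R -> R) (y : R) : R :=
  g (2^-1 * (`|y| + y)) - g (2^-1 * (`|y| - y)).

Lemma continuous_odd_extension g : continuous g -> continuous (odd_extension g).
Proof.
move=> cg y; apply: cvgB.
  apply: (cvg_comp _ g _ (cg _)); apply: cvgM; first exact: cvg_cst.
  by apply: cvgD; [exact: norm_continuous|exact: cvg_id].
apply: (cvg_comp _ g _ (cg _)); apply: cvgM; first exact: cvg_cst.
by apply: cvgB; [exact: norm_continuous|exact: cvg_id].
Qed.

Lemma odd_extensionM g (y : R) : g 0 = 0 -> odd_extension g y * y = `|y| * g `|y|.
Proof.
move=> g0; rewrite /odd_extension; have [y0|y0] := leP 0 y.
  by rewrite ger0_norm// subrr mulr0 g0 subr0 (_ : 2^-1 * _ = y) 1?mulrC//; field.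
rewrite ltr0_norm// addNr mulr0 g0 sub0r.
by rewrite (_ : 2^-1 * _ = - y); [ring|field].
Qed.

Lemma odd_extension_sg g (y : R) : g 0 = 0 -> odd_extension g y * Num.sg y = g `|y|.
Proof.
move=> g0; have [->|y0] := eqVneq y 0; first by rewrite sgr0 normr0 mulr0.
apply: (mulIf (_ : `|y| != 0)); first by rewrite normr_eq0.
by rewrite -mulrA -[Num.sg y * _]numEsg odd_extensionM// mulrC.
Qed.

(** The odd extension of a C1 function has the even derivative [dg |y|]. At [y = 0] the kinks of the
    two parts cancel: each part contributes one half of [dg 0 * z]. *)
Lemma bounded_cvg_symq_odd_extension (g dg : R -> R) y z :
  continuously_differentiable g dg -> bounded_rv y -> bounded_rv z ->
  bounded_cvg (symq (fun k w => odd_extension g (turn y (fun w => - z w) k w))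
                    (fun k w => odd_extension g (turn y z k w)))
              (fun w => dg `|y w| * z w).
Proof.
move=> Cg by_ bz; have bNz := bounded_rvN bz.
have [bp bm] := (bounded_cvg_turn by_ bz, bounded_cvg_turn by_ bNz).
have [bnp bnm] := (bounded_cvg_norm bp, bounded_cvg_norm bm).
have bq := bounded_cvg_symq_turn by_ bz.
have bnq := bounded_cvg_symq_norm by_ bz.
have bh : bounded_cvg (fun _ (_ : T) => 2^-1 : R) (fun=> 2^-1).
  exact/bounded_cvg_cst/bounded_rv_cst.
have h1 := bounded_cvgM bh (bounded_cvgD bnq bq).
have h2 := bounded_cvgM bh (bounded_cvgB bnq bq).
have k1 : bounded_cvg (fun k w => (2^-1 * (`|turn y z k w| + turn y z k w)
    - 2^-1 * (`|turn y (fun w => - z w) k w| + turn y (fun w => - z w) k w))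
    / (2 * rot_sin k)) (fun w => 2^-1 * (Num.sg (y w) * z w + z w)).
  move: h1; congr bounded_cvg.
  by apply/funext => k; apply/funext => w; rewrite /symq; ring.
have k2 : bounded_cvg (fun k w => (2^-1 * (`|turn y z k w| - turn y z k w)
    - 2^-1 * (`|turn y (fun w => - z w) k w| - turn y (fun w => - z w) k w))
    / (2 * rot_sin k)) (fun w => 2^-1 * (Num.sg (y w) * z w - z w)).
  move: h2; congr bounded_cvg.
  by apply/funext => k; apply/funext => w; rewrite /symq; ring.
have q1 := bounded_cvg_difference_quotient Cg
  (bounded_cvgM bh (bounded_cvgD bnm bm)) (bounded_cvgM bh (bounded_cvgD bnp bp)) k1.
have q2 := bounded_cvg_difference_quotient Cg
  (bounded_cvgM bh (bounded_cvgB bnm bm)) (bounded_cvgM bh (bounded_cvgB bnp bp)) k2.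
have := bounded_cvgB q1 q2; congr bounded_cvg.
  by apply/funext => k; apply/funext => w; rewrite /symq /odd_extension; ring.
apply/funext => w; have [y0|y0|y0] := ltgtP (y w) 0.
- rewrite (ltr0_sg y0) (ltr0_norm y0) (_ : 2^-1 * (- y w - y w) = - y w); last by field.
  by field.
- rewrite (gtr0_sg y0) (gtr0_norm y0) (_ : 2^-1 * (y w + y w) = y w); last by field.
  by field.
- by rewrite y0 sgr0 normr0 subr0 addr0 mulr0; field.
Qed.

End symmetric_quotients.

(** * Integration by parts on the sphere *)

Section integration_by_parts_on_the_sphere.
Context {d : measure_display} {T : measurableType d} {R : realType} {n : nat}.
Variables (P : probability T R) (U : T -> 'rV[R]_n).
Hypothesis unifU : uniform_on_sphere P U.

Definition scaled_coord (l : 'I_n) (w : T) : R := Num.sqrt n%:R * U w ord0 l.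
Local Notation y := scaled_coord.

Lemma sum_sqr_scaled_coord w : \sum_(l < n) y l w ^+ 2 = n%:R.
Proof.
have [_ [U1 _]] := unifU; under eq_bigr do rewrite exprMn sqr_sqrtr ?ler0n//.
by rewrite -mulr_sumr -[RHS]mulr1 -(U1 w).
Qed.

Lemma bounded_rv_scaled_coord l : bounded_rv (y l).
Proof.
have [mU _] := unifU; split; first by apply: measurable_funM => //; exact: mU.
exists (Num.sqrt n%:R) => w.
rewrite -(@ler_pXn2r _ 2)// ?nnegrE ?sqrtr_ge0//.
rewrite real_normK ?num_real// sqr_sqrtr ?ler0n// -(sum_sqr_scaled_coord w).
by rewrite (bigD1 l)//= lerDl sumr_ge0// => i _; rewrite sqr_ge0.
Qed.

(** Invariance is given on open sets. For continuous [F] the sets [F > r] are open, so [F (U w)] and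
    [F (U w *m O)] have the same tails, hence the same mean. *)
Lemma mean_orthogonal (F : 'rV[R]_n -> R) (O : 'M[R]_n) : O *m O^T = 1%:M ->
  continuous F -> bounded_rv (fun w => F (U w)) ->
  bounded_rv (fun w => F (U w *m O)) ->
  mean P (fun w => F (U w *m O)) = mean P (fun w => F (U w)).
Proof.
move=> OO cF b1 b2; apply: eq_mean_ccdf => // r.
have [_ [_ inv]] := unifU.
rewrite (inv O OO [set u | r < F u])//.
by apply: (@open_comp _ _ F [set x | r < x]) => [u _|]; [exact: cF|exact: open_gt].
Qed.

Section pair.
Variables (i j : 'I_n) (g dg h dh f df : R -> R).
Hypotheses (ij : i != j) (g0 : g 0 = 0).
Hypotheses (Cg : continuously_differentiable g dg)
  (Ch : continuously_differentiable h dh) (Cf : continuously_differentiable f df).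

Let r : R := Num.sqrt n%:R.
Let V w := \sum_(l < n) h `|y l w|.

Let F (u : 'rV[R]_n) : R := (r * u ord0 i) * odd_extension g (r * u ord0 j)
  * f (\sum_(l < n) h `|r * u ord0 l|).

Let contF : continuous F.
Proof.
have cc l : continuous (fun u : 'rV[R]_n => r * u ord0 l).
  move=> u; apply: (cvg_comp _ _ (@coord_continuous R 1 n ord0 l u)).
  exact: mulrl_continuous.
have [[[gd _] [hd _]] [fd _]] := (Cg, Ch, Cf).
have cq := continuous_odd_extension (is_derive1_continuous gd).
have ch := is_derive1_continuous hd; have cf := is_derive1_continuous fd.
have cv : continuous (fun u : 'rV[R]_n => \sum_(l < n) h `|r * u ord0 l|).
  apply: continuous_big => [|l _ u]; first exact: add_continuous.
  have c0 := cvg_comp _ _ (cc l u) (@norm_continuous _ R _).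
  exact: (cvg_comp _ _ c0 (ch _)).
have c1 u := cvg_comp _ _ (cc j u) (cq _).
have c2 u := cvg_comp _ _ (cv u) (cf _).
by move=> u; exact: cvgM (cvgM (cc i u) (c1 u)) (c2 u).
Qed.

Let rest w := \sum_(l < n | (l != i) && (l != j)) h `|y l w|.

Let FE (c s : R) w : F (U w *m givens i j c s) =
  (c * y i w + s * y j w) * odd_extension g (c * y j w - s * y i w) *
  f (rest w + (h `|c * y i w + s * y j w| + h `|c * y j w - s * y i w|)).
Proof.
rewrite /F (bigD1 i)//= (bigD1 j)/=; last by rewrite eq_sym.
rewrite !givensE// !eqxx eq_sym (negbTE ij).
have E1 : r * (c * U w ord0 i + s * U w ord0 j) = c * y i w + s * y j w.
  by rewrite /y -/r; ring.
have E2 : r * (c * U w ord0 j - s * U w ord0 i) = c * y j w - s * y i w.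
  by rewrite /y -/r; ring.
rewrite E1 E2; congr (_ * f _); rewrite addrA addrC; congr (_ + _).
by apply: eq_bigr => l /andP[/negbTE li /negbTE lj]; rewrite givensE// li lj.
Qed.

(** The derivative at angle zero of [F] along the rotation in the plane [(i, j)], where [y i] moves
    with speed [y j] and [y j] with speed [- y i]. The signs pair up because the middle factor of
    [F] is odd, leaving absolute values only. *)
Definition pair_term w : R :=
  (`|y j w| * g `|y j w| - `|y i w| ^+ 2 * dg `|y j w|) * f (V w)
  + df (V w) * (`|y i w| * dh `|y i w| * (`|y j w| * g `|y j w|)
                - `|y i w| ^+ 2 * (g `|y j w| * dh `|y j w|)).

(** The rotations by opposite angles both preserve the mean of [F], so the symmetric quotient of [F]
    has mean zero for every [k]; dominated convergence passes to the limit [pair_term]. *)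
Lemma mean_pair_term : bounded_rv pair_term /\ mean P pair_term = 0.
Proof.
have [[[gd _] [hd _]] [fd _]] := (Cg, Ch, Cf).
have cf := is_derive1_continuous fd; have ch := is_derive1_continuous hd.
have cq := continuous_odd_extension (is_derive1_continuous gd).
have [bi bj] := (bounded_rv_scaled_coord i, bounded_rv_scaled_coord j).
have [bNi bNj] := (bounded_rvN bi, bounded_rvN bj).
have bNNi := bounded_rvN bNi.
pose ip := turn (y i) (y j); pose im := turn (y i) (fun w => - y j w).
pose jp := turn (y j) (fun w => - y i w).
pose jm := turn (y j) (fun w => - - y i w).
have bip : bounded_cvg ip (y i) by exact: bounded_cvg_turn.
have bim : bounded_cvg im (y i) by exact: bounded_cvg_turn.
have bjp : bounded_cvg jp (y j) by exact: bounded_cvg_turn.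
have bjm : bounded_cvg jm (y j) by exact: bounded_cvg_turn.
have brest : bounded_cvg (fun=> rest) rest.
  apply: bounded_cvg_cst; apply: bounded_rv_sum => l _.
  apply: bounded_rv_comp => //; apply: bounded_rv_norm.
  exact: bounded_rv_scaled_coord.
pose Vp k w := rest w + (h `|ip k w| + h `|jp k w|).
pose Vm k w := rest w + (h `|im k w| + h `|jm k w|).
have VE w : V w = rest w + (h `|y i w| + h `|y j w|).
  rewrite /V (bigD1 i)//= (bigD1 j)/=; last by rewrite eq_sym.
  by rewrite addrA addrC.
have bVp : bounded_cvg Vp V.
  rewrite (funext VE); apply: bounded_cvgD => //.
  by apply: bounded_cvgD; apply: bounded_cvg_comp => //; exact: bounded_cvg_norm.
have bVm : bounded_cvg Vm V.
  rewrite (funext VE); apply: bounded_cvgD => //.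
  by apply: bounded_cvgD; apply: bounded_cvg_comp => //; exact: bounded_cvg_norm.
have qh1 := bounded_cvg_difference_quotient Ch (bounded_cvg_norm bim)
  (bounded_cvg_norm bip) (bounded_cvg_symq_norm bi bj).
have qh2 := bounded_cvg_difference_quotient Ch (bounded_cvg_norm bjm)
  (bounded_cvg_norm bjp) (bounded_cvg_symq_norm bj bNi).
pose dV w := dh `|y i w| * (Num.sg (y i w) * y j w)
             + dh `|y j w| * (Num.sg (y j w) * - y i w).
have qV : bounded_cvg (fun k w => (Vp k w - Vm k w) / (2 * rot_sin k)) dV.
  have := bounded_cvgD qh1 qh2; congr bounded_cvg.
  by apply/funext => k; apply/funext => w; rewrite /Vp /Vm; ring.
have qf := bounded_cvg_difference_quotient Cf bVm bVp qV.
have qg := bounded_cvg_symq_odd_extension Cg bj bNi.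
have qi := bounded_cvg_symq_turn bi bj.
(* Product rule for the quotient of three factors: one factor at a time goes from its minus to its
   plus version, the later ones staying at plus and the earlier ones at minus. *)
have b1 := bounded_cvgM (bounded_cvgM qi (bounded_cvg_comp cq bjp))
                        (bounded_cvg_comp cf bVp).
have b2 := bounded_cvgM (bounded_cvgM bim qg) (bounded_cvg_comp cf bVp).
have b3 := bounded_cvgM (bounded_cvgM bim (bounded_cvg_comp cq bjm)) qf.
pose Psip k w := ip k w * odd_extension g (jp k w) * f (Vp k w).
pose Psim k w := im k w * odd_extension g (jm k w) * f (Vm k w).
have bPsip k : bounded_rv (Psip k).
  apply: bounded_cvg_rv.
  exact: bounded_cvgM (bounded_cvgM bip (bounded_cvg_comp cq bjp)) (bounded_cvg_comp cf bVp).
have bPsim k : bounded_rv (Psim k).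
  apply: bounded_cvg_rv.
  exact: bounded_cvgM (bounded_cvgM bim (bounded_cvg_comp cq bjm)) (bounded_cvg_comp cf bVm).
have PsipE k w : Psip k w = F (U w *m givens i j (rot_cos k) (rot_sin k)).
  by rewrite FE /Psip /Vp /ip /jp /turn mulrN.
have PsimE k w : Psim k w = F (U w *m givens i j (rot_cos k) (- rot_sin k)).
  by rewrite FE /Psim /Vm /im /jm /turn !mulrN !mulNr opprK.
have bF : bounded_rv (fun w => F (U w)).
  have <- : (fun w => F (U w *m givens i j 1 0)) = fun w => F (U w).
    by apply/funext => w; rewrite /givens subrr !scale0r !addr0 mulmx1.
  rewrite (funext (FE 1 0)).
  have e1 : (fun w => 1 * y i w + 0 * y j w) = y i.
    by apply/funext => w; rewrite mul1r mul0r addr0.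
  have e2 : (fun w => 1 * y j w - 0 * y i w) = y j.
    by apply/funext => w; rewrite mul1r mul0r subr0.
  apply: bounded_rvM; first apply: bounded_rvM; first by rewrite e1.
    by apply: bounded_rv_comp => //; rewrite e2.
  apply: bounded_rv_comp => //; apply: bounded_rvD.
    exact: (bounded_cvg_rv 0 brest).
  by apply: bounded_rvD; apply: bounded_rv_comp => //; apply: bounded_rv_norm;
    rewrite ?e1 ?e2.
have eqmean k : mean P (Psip k) = mean P (Psim k).
  rewrite (funext (PsipE k)) (funext (PsimE k)) !mean_orthogonal//.
  - by apply: givens_orthogonal => //; rewrite sqrrN rot_cos_sin.
  - by rewrite -(funext (PsimE k)).
  - by apply: givens_orthogonal => //; rewrite rot_cos_sin.
  - by rewrite -(funext (PsipE k)).
have main : bounded_cvg (symq Psim Psip) pair_term.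
  have := bounded_cvgD (bounded_cvgD b1 b2) b3; congr bounded_cvg.
    apply/funext => k; apply/funext => w.
    by rewrite /symq /Psip /Psim -/ip -/im -/jp -/jm; ring.
  apply/funext => w; rewrite /pair_term /dV.
  rewrite -(odd_extensionM _ g0).
  have -> : g `|y j w| * dh `|y j w| =
     odd_extension g (y j w) * Num.sg (y j w) * dh `|y j w|.
    by rewrite odd_extension_sg.
  have -> : `|y i w| * dh `|y i w| = Num.sg (y i w) * y i w * dh `|y i w|.
    by rewrite -normrEsg.
  rewrite real_normK ?num_real//; ring.
have [brv cvgm] := bounded_cvg_mean P main; split => //.
have z : (fun k => mean P (symq Psim Psip k)) = fun=> 0.
  apply/funext => k; rewrite -[RHS](mulr0 (2 * rot_sin k)^-1).
  rewrite -[X in _ = _ * X](subrr (mean P (Psim k))) -{1}eqmean -meanB// -meanZ//.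
    by apply: eq_mean => w; rewrite /symq mulrC.
  exact: bounded_rvB.
by rewrite z in cvgm; rewrite -(cvg_lim _ cvgm)// lim_cst.
Qed.

End pair.
End integration_by_parts_on_the_sphere.

Section stein_identities_on_the_sphere.
Context {d : measure_display} {T : measurableType d} {R : realType} {n : nat}.
Variables (P : probability T R) (U : T -> 'rV[R]_n).
Hypothesis unifU : uniform_on_sphere P U.

Definition coord_sum (a : R -> R) (w : T) : R :=
  \sum_(l < n) a `|scaled_coord U l w|.

Lemma bounded_rv_coord_sum a : continuous a -> bounded_rv (coord_sum a).
Proof.
move=> ca; apply: bounded_rv_sum => l _; apply: bounded_rv_comp => //.
by apply: bounded_rv_norm; exact: bounded_rv_scaled_coord unifU l.
Qed.

(** The average of [y ^+ 2] is exactly [1], hence so is that of [t + (1 - t) y ^+ 2]. The values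
    [t = 1], [0] and [1 / 2] serve functions of constant, quadratic and linear growth. *)
Lemma norm_coord_sum_le (a : R -> R) (C t : R) w :
  (forall x, 0 <= x -> `|a x| <= C * (t + (1 - t) * x ^+ 2)) ->
  `|coord_sum a w| <= C * n%:R.
Proof.
move=> aC; rewrite (le_trans (ler_norm_sum _ _ _))//.
rewrite (le_trans (ler_sum _ (fun l _ => aC _ (normr_ge0 _))))//.
rewrite -mulr_sumr big_split/= -mulr_sumr.
under [X in _ + _ * X]eq_bigr do rewrite real_normK ?num_real//.
rewrite (sum_sqr_scaled_coord unifU) sumr_const card_ord -[t *+ n]mulr_natl.
by rewrite (_ : n%:R * t + (1 - t) * n%:R = n%:R)//; ring.
Qed.

Lemma coord_sum_lin4 (a1 a2 a3 a4 : R -> R) (c1 c2 c3 c4 : R) w :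
  \sum_(l < n) (c1 * a1 `|scaled_coord U l w| + c2 * a2 `|scaled_coord U l w| +
    c3 * a3 `|scaled_coord U l w| + c4 * a4 `|scaled_coord U l w|) =
  c1 * coord_sum a1 w + c2 * coord_sum a2 w +
  c3 * coord_sum a3 w + c4 * coord_sum a4 w.
Proof. by rewrite !big_split/= -!mulr_sumr. Qed.

(** [J] is the sum of [pair_term] over all [i != j]. Its last term, [- f (V w) * (S1 w - S4 w)],
    corrects for the diagonal. *)
Lemma sphere_integration_by_parts (g dg h dh f df : R -> R) : g 0 = 0 ->
  continuously_differentiable g dg -> continuously_differentiable h dh ->
  continuously_differentiable f df ->
  let S1 := coord_sum (fun x => x * g x) in
  let S2 := coord_sum dg in
  let S3 := coord_sum (fun x => g x * dh x) in
  let S4 := coord_sum (fun x => x ^+ 2 * dg x) in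
  let X1 := coord_sum (fun x => x * dh x) in
  let V := coord_sum h in
  let J w := n%:R * f (V w) * (S1 w - S2 w)
             + df (V w) * (X1 w * S1 w - n%:R * S3 w)
             - f (V w) * (S1 w - S4 w) in
  bounded_rv J /\ mean P J = 0.
Proof.
move=> g0 Cg Ch Cf S1 S2 S3 S4 X1 V J.
have pt i j : i != j -> _ := fun ij => mean_pair_term unifU ij g0 Cg Ch Cf.
have -> : J = fun w => \sum_(j < n) \sum_(i < n | i != j)
                         pair_term U i j g dg h dh f df w.
  apply/funext => w; apply/esym.
  pose z l := `|scaled_coord U l w|.
  pose A j := z j * g (z j) * f (V w).
  pose B j := - (dg (z j) * f (V w)) - df (V w) * (g (z j) * dh (z j)).
  pose C j := df (V w) * (z j * g (z j)).
  have ptE i j : pair_term U i j g dg h dh f df w =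
      A j + z i ^+ 2 * B j + z i * dh (z i) * C j.
    by rewrite /pair_term -/(V w) /A /B /C /z; ring.
  have sE j : \sum_(i < n | i != j) pair_term U i j g dg h dh f df w =
      (n%:R * A j + n%:R * B j + X1 w * C j) - (A j - z j ^+ 2 * (dg (z j) * f (V w))).
    (* The formula for [pair_term] makes sense for [i = j] too, and its [df] part cancels there.
       Adding this diagonal term completes the sum over [i], so that the squares sum to [n]. *)
    have -> : A j - z j ^+ 2 * (dg (z j) * f (V w)) =
        pair_term U j j g dg h dh f df w.
      by rewrite ptE /A /B /C; ring.
    apply/eqP; rewrite -subr_eq0 opprB addrA subr_eq0 addrC -[X in X == _]/(_ + _).
    rewrite -(bigD1 (P := xpredT) j)//=; apply/eqP.
    under eq_bigr do rewrite ptE.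
    rewrite !big_split/=; congr (_ + _ + _).
    - by rewrite sumr_const card_ord mulr_natl.
    - rewrite -mulr_suml; congr (_ * _).
      under eq_bigr do rewrite real_normK ?num_real//.
      exact: sum_sqr_scaled_coord unifU w.
    - by rewrite -mulr_suml.
  under eq_bigr do rewrite sE.
  transitivity (\sum_(l < n) ((n%:R * f (V w) + df (V w) * X1 w - f (V w)) * (z l * g (z l))
     + (- (n%:R * f (V w))) * dg (z l)
     + (- (df (V w) * n%:R)) * (g (z l) * dh (z l))
     + f (V w) * (z l ^+ 2 * dg (z l)))).
    by apply: eq_bigr => l _; rewrite /A /B /C; ring.
  rewrite (coord_sum_lin4 (fun x => x * g x) dg (fun x => g x * dh x)
            (fun x => x ^+ 2 * dg x)).
  by rewrite /J -/S1 -/S2 -/S3 -/S4; ring.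
have bs j : bounded_rv (fun w => \sum_(i < n | i != j) pair_term U i j g dg h dh f df w).
  by apply: bounded_rv_sum => i ij; have [] := pt i j ij.
split; first by apply: bounded_rv_sum => j _; exact: bs.
rewrite mean_sum// big1// => j _; rewrite mean_sum.
  by rewrite big1// => i ij; have [] := pt i j ij.
by move=> i ij; have [] := pt i j ij.
Qed.

End stein_identities_on_the_sphere.

(** * Stein's equation and the empirical averages *)

Section stein_pairs.
Context {R : realType}.
Implicit Types (g dg h dh f df : R -> R) (c L : R).

Lemma norm_le_linear f df (D : R) : (forall x : R, is_derive x 1 f (df x)) ->
  (forall x, `|df x| <= D) -> forall x, `|f x| <= `|f 0| + D * `|x|.
Proof.
move=> fd dfD x; have [y _ e] := MVT_between fd 0 x.
rewrite -(subrK (f 0) (f x)) e subr0 addrC.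
by rewrite (le_trans (ler_normD _ _))// lerD2l normrM ler_wpM2r.
Qed.

(* [g] solves Stein's equation for [h - c] on the half-line; only the values at
   [x >= 0] matter, the derivatives on the negative side are never evaluated. *)
Record stein_pair g dg h dh c L : Prop := SteinPair {
  stein_g0 : g 0 = 0;
  stein_Cg : continuously_differentiable g dg;
  stein_Ch : continuously_differentiable h dh;
  stein_eq : forall x, 0 <= x -> dg x - x * g x = h x - c;
  stein_dg : forall x, 0 <= x -> `|dg x| <= L;
  stein_dh : forall x, 0 <= x -> `|dh x| <= L }.

Lemma stein_pair_L_ge0 g dg h dh c L : stein_pair g dg h dh c L -> 0 <= L.
Proof. by move=> sp; apply: le_trans (stein_dg sp (lexx 0)). Qed.

Lemma stein_pair_g g dg h dh c L : stein_pair g dg h dh c L ->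
  forall x, 0 <= x -> `|g x| <= L * x.
Proof.
move=> sp x x0; have [gd _] := stein_Cg sp.
have [y /andP[y0 _]] := MVT_le x0 (fun x _ => gd x).
rewrite (stein_g0 sp) !subr0 => ->; rewrite normrM (ger0_norm x0).
by rewrite ler_wpM2r//; exact: stein_dg sp _ y0.
Qed.

End stein_pairs.

Section sphere_limit_theorems.
Context {d : measure_display} {T : measurableType d} {R : realType} {n : nat}.
Variables (P : probability T R) (U : T -> 'rV[R]_n).
Hypothesis n0 : (0 < n)%N.
Hypothesis unifU : uniform_on_sphere P U.
Local Notation coord_sum := (coord_sum U).

Let nR : 0 < n%:R :> R. Proof. by rewrite ltr0n. Qed.

Section bounds.
Variables (g dg h dh : R -> R) (c L : R).
Hypothesis sp : stein_pair g dg h dh c L.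

Let L0 : 0 <= L := stein_pair_L_ge0 sp.
Let gL := stein_pair_g sp.

Lemma coord_sum_xg w : `|coord_sum (fun x => x * g x) w| <= L * n%:R.
Proof.
apply: (norm_coord_sum_le unifU (t := 0)) => x x0.
rewrite normrM (ger0_norm x0) add0r subr0 mul1r expr2 mulrCA.
by rewrite ler_wpM2l// gL.
Qed.

Lemma coord_sum_dg w : `|coord_sum dg w| <= L * n%:R.
Proof.
apply: (norm_coord_sum_le unifU (t := 1)) => x x0.
by rewrite subrr mul0r addr0 mulr1; exact: stein_dg sp _ x0.
Qed.

Lemma coord_sum_x2dg w : `|coord_sum (fun x => x ^+ 2 * dg x) w| <= L * n%:R.
Proof.
apply: (norm_coord_sum_le unifU (t := 0)) => x x0.
rewrite normrM (ger0_norm (sqr_ge0 x)) add0r subr0 mul1r mulrC.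
by rewrite ler_wpM2r ?sqr_ge0//; exact: stein_dg sp _ x0.
Qed.

Lemma half_AMGM (C x : R) : 0 <= C -> C * x <= C * (2^-1 + (1 - 2^-1) * x ^+ 2).
Proof. by move=> C0; rewrite ler_wpM2l//; have := sqr_ge0 (x - 1); nra. Qed.

Lemma coord_sum_xdh w : `|coord_sum (fun x => x * dh x) w| <= L * n%:R.
Proof.
apply: (norm_coord_sum_le unifU (t := 2^-1)) => x x0.
apply: le_trans (half_AMGM x L0).
by rewrite normrM (ger0_norm x0) mulrC ler_wpM2r//; exact: stein_dh sp _ x0.
Qed.

Lemma coord_sum_gdh w : `|coord_sum (fun x => g x * dh x) w| <= L ^+ 2 * n%:R.
Proof.
apply: (norm_coord_sum_le unifU (t := 2^-1)) => x x0.
apply: le_trans (half_AMGM x (sqr_ge0 L)).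
rewrite normrM expr2 mulrAC ler_pM//; first exact: gL.
exact: stein_dh sp _ x0.
Qed.

Lemma coord_sum_stein w : coord_sum h w - n%:R * c =
  coord_sum dg w - coord_sum (fun x => x * g x) w.
Proof.
have -> : n%:R * c = \sum_(l < n) c by rewrite sumr_const card_ord mulr_natl.
rewrite /coord_sum -!sumrB; apply: eq_bigr => l _.
by rewrite (stein_eq sp (normr_ge0 _)).
Qed.

(** With [f x = x - n c], Stein's equation gives [f(V) = S2 - S1], so [n (V - n c)^2 + J] equals
    [X1 S1 - n S3 - f(V) (S1 - S4)]. The deterministic bounds on the sums control these three terms
    by [1], [1] and [4] times [L^2 n^2], whence the [6]. *)
Lemma coord_sum_variance :
  mean P (fun w => (coord_sum h w - n%:R * c) ^+ 2) <= 6 * L ^+ 2 * n%:R.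
Proof.
have Cf : continuously_differentiable (fun x => x - n%:R * c) (fun=> 1 : R).
  split; last by move=> x; exact: cvg_cst.
  by move=> x; rewrite -[X in is_derive _ _ _ X]subr0; exact: is_deriveB.
have [] := sphere_integration_by_parts unifU (stein_g0 sp) (stein_Cg sp)
  (stein_Ch sp) Cf.
set J := (X in bounded_rv X) => bJ J0.
have ch : continuous h by have [/is_derive1_continuous] := stein_Ch sp.
have bS : bounded_rv (fun w => (coord_sum h w - n%:R * c) ^+ 2).
  apply: bounded_rvX; apply: bounded_rvB; last exact: bounded_rv_cst.
  exact: bounded_rv_coord_sum unifU _ ch.
rewrite -(ler_pM2l nR) -meanZ//.
have -> : n%:R * (6 * L ^+ 2 * n%:R) =
    mean P (fun w => - 1 * J w + 6 * L ^+ 2 * n%:R ^+ 2).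
  rewrite meanD; [|exact: bounded_rvZ|exact: bounded_rv_cst].
  by rewrite mean_cst meanZ// J0; ring.
apply: le_mean.
- exact: bounded_rvZ.
- by apply: bounded_rvD; [exact: bounded_rvZ|exact: bounded_rv_cst].
move=> w; rewrite /J coord_sum_stein.
have := coord_sum_xg w; have := coord_sum_dg w; have := coord_sum_x2dg w.
have := coord_sum_xdh w; have := coord_sum_gdh w.
move: (coord_sum (fun x => x * g x) w) (coord_sum dg w)
  (coord_sum (fun x => x ^+ 2 * dg x) w) (coord_sum (fun x => x * dh x) w)
  (coord_sum (fun x => g x * dh x) w) => s1 s2 s4 x1 s3.
move=> hs3 hx1 hs4 hs2 hs1.
have e1 : `|x1 * s1| <= L * n%:R * (L * n%:R) by rewrite normrM ler_pM.
have e2 : `|n%:R * s3| <= n%:R * (L ^+ 2 * n%:R).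
  by rewrite normrM (gtr0_norm nR) ler_wpM2l ?ler0n.
have e3 : `|(s2 - s1) * (s1 - s4)| <=
    (L * n%:R + L * n%:R) * (L * n%:R + L * n%:R).
  rewrite normrM ler_pM// (le_trans (ler_normB _ _))// lerD//.
move: e1 e2 e3; rewrite !ler_norml => /andP[_ e1] /andP[e2 _] /andP[e3 _].
rewrite -subr_ge0; set X := (X in 0 <= X).
have -> : X = (L * n%:R * (L * n%:R) - x1 * s1) + (n%:R * s3 - - (n%:R * (L ^+ 2 * n%:R)))
  + ((s2 - s1) * (s1 - s4) - - ((L * n%:R + L * n%:R) * (L * n%:R + L * n%:R))).
  rewrite /X; ring.
by apply: addr_ge0; [apply: addr_ge0|]; rewrite subr_ge0.
Qed.

End bounds.
End sphere_limit_theorems.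

Definition normalized_sum {d : measure_display} {T : measurableType d}
    {R : realType} {n : nat}
    (U : T -> 'rV[R]_n) (m : R) (w : T) : R :=
  (coord_sum U id w - n%:R * m) / Num.sqrt n%:R.

Section stein_estimate.
Context {R : realType} (g dg ga dga gb dgb f df : R -> R) (m ca cb L D : R).
Hypotheses (spp : stein_pair g dg id (fun=> 1) m L)
  (spa : stein_pair ga dga g dg ca L)
  (spb : stein_pair gb dgb (fun x => x * g x) (fun x => g x + x * dg x) cb L)
  (Cf : continuously_differentiable f df) (dfD : forall x, `|df x| <= D).

(** Independent of [n] and of the probability space. [K] bounds the mean of [1 + (X - n a)^2 / n]
    for each of the three empirical sums [X]; the first summand controls the fluctuation of the
    coefficient of [df], the second the diagonal correction. *)
Definition stein_bound : R := let K := 1 + 6 * L ^+ 2 in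
  2^-1 * D * (2 + `|cb|) * K + 2 * L * (`|f 0| + 2^-1 * D * K).

(** Used with [r = sqrt n]: the arithmetic-geometric inequality makes a variance bound enough to see
    that the fluctuation of an average is of order [n^(-1/2)] in mean. *)
Lemma norm_le_inv_sqrt (r x : R) : 0 < r ->
  `|x| / r ^+ 2 <= r^-1 * (2^-1 * (1 + x ^+ 2 / r ^+ 2)).
Proof.
move=> r0; rewrite -(real_normK (num_real x)) -subr_ge0.
have -> : r^-1 * (2^-1 * (1 + `|x| ^+ 2 / r ^+ 2)) - `|x| / r ^+ 2 =
    (2 * r)^-1 * (1 - `|x| / r) ^+ 2 by field; rewrite gt_eqF.
by rewrite mulr_ge0 ?sqr_ge0// invr_ge0 mulr_ge0// ltW.
Qed.

Lemma stein_estimate (d : measure_display) (T : measurableType d) (n : nat)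
    (P : probability T R) (U : T -> 'rV[R]_n) :
  (0 < n)%N -> uniform_on_sphere P U ->
  `|mean P (fun w => normalized_sum U m w * f (normalized_sum U m w)
                     - (m * cb - ca) * df (normalized_sum U m w))|
    <= stein_bound / Num.sqrt n%:R.
Proof.
move=> n0 unifU; set W := normalized_sum U m; set r := Num.sqrt n%:R.
have r0 : 0 < r by rewrite sqrtr_gt0 ltr0n.
have r2 : n%:R = r ^+ 2 by rewrite sqr_sqrtr ?ler0n.
have L0 := stein_pair_L_ge0 spp.
have D0 : 0 <= D by apply: le_trans (dfD 0).
have [fd cdf] := Cf.
pose F x := f ((x - n%:R * m) / r); pose dF x := df ((x - n%:R * m) / r) / r.
have CF : continuously_differentiable F dF.
  apply: (eq_C1 (C1_comp Cf (C1M (C1B C1_id (C1_cst (n%:R * m))) (C1_cst r^-1)))).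
    by [].
  by move=> x; rewrite /dF subr0 mul1r mulr0 addr0.
have [] := sphere_integration_by_parts unifU (stein_g0 spp) (stein_Cg spp)
  (stein_Ch spp) CF.
set J := (X in bounded_rv X) => bJ J0.
have bSp : bounded_rv (coord_sum U id).
  by apply: (bounded_rv_coord_sum unifU) => x; exact: cvg_id.
have bW : bounded_rv W.
  by apply: bounded_rvM; [apply: bounded_rvB => //|]; exact: bounded_rv_cst.
have cf := is_derive1_continuous fd.
have [[gd _] [xgd _]] := (stein_Cg spp, stein_Ch spb).
have bSa : bounded_rv (coord_sum U g).
  exact: bounded_rv_coord_sum unifU _ (is_derive1_continuous gd).
have bSb : bounded_rv (coord_sum U (fun x => x * g x)).
  exact: bounded_rv_coord_sum unifU _ (is_derive1_continuous xgd).
have b2 X (a : R) : bounded_rv X ->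
    bounded_rv (fun w => 1 + (r ^+ 2)^-1 * (X w - n%:R * a) ^+ 2).
  move=> bX; apply: bounded_rvD; first exact: bounded_rv_cst.
  apply: bounded_rvZ.
  by apply: bounded_rvX; apply: bounded_rvB => //; exact: bounded_rv_cst.
have m2 X (a : R) : bounded_rv X ->
    mean P (fun w => (X w - n%:R * a) ^+ 2) <= 6 * L ^+ 2 * n%:R ->
    mean P (fun w => 1 + (r ^+ 2)^-1 * (X w - n%:R * a) ^+ 2) <= 1 + 6 * L ^+ 2.
  move=> bX; have bX2 : bounded_rv (fun w => (X w - n%:R * a) ^+ 2).
    by apply: bounded_rvX; apply: bounded_rvB => //; exact: bounded_rv_cst.
  rewrite meanD; [|exact: bounded_rv_cst|exact: bounded_rvZ].
  by rewrite mean_cst meanZ// lerD2l ler_pdivrMl ?exprn_gt0// -r2 [leRHS]mulrC.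
pose Qp w := 1 + (r ^+ 2)^-1 * (coord_sum U id w - n%:R * m) ^+ 2.
pose Qa w := 1 + (r ^+ 2)^-1 * (coord_sum U g w - n%:R * ca) ^+ 2.
pose Qb w := 1 + (r ^+ 2)^-1 * (coord_sum U (fun x => x * g x) w - n%:R * cb) ^+ 2.
have [bQp bQa bQb] : [/\ bounded_rv Qp, bounded_rv Qa & bounded_rv Qb].
  by split; exact: b2.
have mQp : mean P Qp <= 1 + 6 * L ^+ 2 by apply: m2 => //; exact: coord_sum_variance spp.
have mQa : mean P Qa <= 1 + 6 * L ^+ 2 by apply: m2 => //; exact: coord_sum_variance spa.
have mQb : mean P Qb <= 1 + 6 * L ^+ 2 by apply: m2 => //; exact: coord_sum_variance spb.
pose B w := 2^-1 * D * (Qb w + `|cb| * Qp w + Qa w)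
            + 2 * L * (`|f 0| + 2^-1 * D * Qp w).
have bB1 : bounded_rv (fun w => Qb w + `|cb| * Qp w + Qa w).
  by do 2?apply: bounded_rvD => //; exact: bounded_rvZ.
have bB2 : bounded_rv (fun w => `|f 0| + 2^-1 * D * Qp w).
  by apply: bounded_rvD; [exact: bounded_rv_cst|exact: bounded_rvZ].
have bB : bounded_rv B by apply: bounded_rvD; exact: bounded_rvZ.
have mB : mean P B <= stein_bound.
  have bcQ : bounded_rv (fun w => `|cb| * Qp w) by exact: bounded_rvZ.
  have e1 : mean P (fun w => Qb w + `|cb| * Qp w + Qa w) =
      mean P Qb + `|cb| * mean P Qp + mean P Qa.
    by rewrite meanD//; [rewrite meanD// meanZ|exact: bounded_rvD].
  have e2 : mean P (fun w => `|f 0| + 2^-1 * D * Qp w) =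
      `|f 0| + 2^-1 * D * mean P Qp.
    by rewrite meanD ?mean_cst ?meanZ//; [exact: bounded_rv_cst|exact: bounded_rvZ].
  rewrite /B meanD; [|exact: bounded_rvZ|exact: bounded_rvZ].
  rewrite !meanZ// e1 e2 /stein_bound lerD//.
    rewrite -[leRHS]mulrA ler_wpM2l ?mulr_ge0 ?invr_ge0//.
    have : `|cb| * mean P Qp <= `|cb| * (1 + 6 * L ^+ 2) by rewrite ler_wpM2l.
    by lra.
  by rewrite ler_wpM2l ?mulr_ge0// lerD2l ler_wpM2l// mulr_ge0 ?invr_ge0.
pose G w := W w * f (W w) - (m * cb - ca) * df (W w).
have bG : bounded_rv G.
  apply: bounded_rvB; first by apply: bounded_rvM => //; exact: bounded_rv_comp.
  by apply: bounded_rvZ; exact: bounded_rv_comp.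
(* Since [J] has mean zero any multiple of it may be added; with the factor [r ^- 3] its first term
   is exactly [- W f(W)]. *)
have -> : mean P G = mean P (fun w => G w + (r ^+ 3)^-1 * J w).
  by rewrite (meanD P bG (bounded_rvZ _ bJ)) meanZ// J0 mulr0 addr0.
apply: (@le_trans _ _ (mean P (fun w => r^-1 * B w))); last first.
  by rewrite meanZ// mulrC ler_wpM2r// invr_ge0 ltW.
apply: le_norm_mean; [|exact: bounded_rvZ|].
  by apply: bounded_rvD => //; exact: bounded_rvZ.
move=> w; rewrite /J /F /dF -/r -[(coord_sum U id w - _) / r]/(W w).
have -> : coord_sum U (fun x => g x * 1) = coord_sum U g.
  by congr coord_sum; apply/funext => x; rewrite mulr1.
have -> : coord_sum U (fun x => x * 1) = coord_sum U id.
  by congr coord_sum; apply/funext => x; rewrite mulr1.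
have hV : `|coord_sum U id w| <= r ^+ 2.
  rewrite -r2 -[leRHS]mul1r; apply: (norm_coord_sum_le unifU (t := 2^-1)) => x x0.
  by rewrite ger0_norm// -[leLHS]mul1r; exact: half_AMGM.
have hst := coord_sum_stein U spp w.
have hs1 := coord_sum_xg unifU spp w; have hs4 := coord_sum_x2dg unifU spp w.
have rN : r != 0 by rewrite gt_eqF.
have WE : W w = (coord_sum U id w - n%:R * m) / r by [].
rewrite /B /G /Qp /Qa /Qb; move: (W w) WE hV hst hs1 hs4 => x.
move: (coord_sum U id w) (coord_sum U (fun x => x * g x) w) (coord_sum U dg w)
  (coord_sum U g w) (coord_sum U (fun x => x ^+ 2 * dg x) w) => V s1 s2 s3 s4.
move=> xE hV hst hs1 hs4.
have s2E : s2 = V - n%:R * m + s1 by rewrite hst subrK.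
(* The product of averages [V / n * (s1 / n)] minus its limit [m cb] is split so that each summand
   has one fluctuation only, multiplied by [V / n], at most [1] in absolute value, or by the
   constant [cb]. *)
have -> : x * f x - (m * cb - ca) * df x + (r ^+ 3)^-1 *
      (n%:R * f x * (s1 - s2) + df x / r * (V * s1 - n%:R * s3) - f x * (s1 - s4)) =
    df x * (V / r ^+ 2 * ((s1 - n%:R * cb) / r ^+ 2) + cb * ((V - n%:R * m) / r ^+ 2)
      - (s3 - n%:R * ca) / r ^+ 2) - f x * ((s1 - s4) / r ^+ 3).
  by rewrite s2E xE r2; field.
have hf : `|f x| <= `|f 0| + D * `|x| by exact: norm_le_linear fd dfD x.
have N a b : `|a / r ^+ b| = `|a| / r ^+ b.
  by rewrite normrM normfV (gtr0_norm (exprn_gt0 _ r0)).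
have nV := norm_le_inv_sqrt (V - n%:R * m) r0.
have n1 := norm_le_inv_sqrt (s1 - n%:R * cb) r0.
have n3 := norm_le_inv_sqrt (s3 - n%:R * ca) r0.
have xb : `|x| <= 2^-1 * (1 + (V - n%:R * m) ^+ 2 / r ^+ 2).
  rewrite xE normrM normfV (gtr0_norm r0) -(ler_pM2l (_ : 0 < r^-1)) ?invr_gt0//.
  by apply: le_trans nV; rewrite mulrCA -invfM -expr2.
have r2V : 0 <= (r ^+ 2)^-1 by rewrite invr_ge0 sqr_ge0.
have t1 : `|df x * (V / r ^+ 2 * ((s1 - n%:R * cb) / r ^+ 2)
      + cb * ((V - n%:R * m) / r ^+ 2) - (s3 - n%:R * ca) / r ^+ 2)| <=
    D * (r^-1 * (2^-1 * (1 + (s1 - n%:R * cb) ^+ 2 / r ^+ 2))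
       + `|cb| * (r^-1 * (2^-1 * (1 + (V - n%:R * m) ^+ 2 / r ^+ 2)))
       + r^-1 * (2^-1 * (1 + (s3 - n%:R * ca) ^+ 2 / r ^+ 2))).
  rewrite normrM ler_pM//.
  rewrite (le_trans (ler_normB _ _))// lerD ?N// (le_trans (ler_normD _ _))// lerD//.
    rewrite normrM -[leRHS]mul1r !N ler_pM ?mulr_ge0//.
    by rewrite ler_pdivrMr ?exprn_gt0// mul1r.
  by rewrite normrM ler_wpM2l ?N.
have t2 : `|f x * ((s1 - s4) / r ^+ 3)| <=
    (`|f 0| + D * (2^-1 * (1 + (V - n%:R * m) ^+ 2 / r ^+ 2))) * (2 * L / r).
  rewrite normrM ler_pM//.
    by rewrite (le_trans hf)// lerD2l ler_wpM2l.
  rewrite N ler_pdivrMr ?exprn_gt0//.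
  rewrite (_ : 2 * L / r * r ^+ 3 = L * n%:R + L * n%:R); last by rewrite r2; field.
  by rewrite (le_trans (ler_normB _ _))// lerD.
rewrite (le_trans (ler_normB _ _))// (le_trans (lerD t1 t2))//.
rewrite le_eqVlt; apply/orP; left; apply/eqP; field; exact: rN.
Qed.

End stein_estimate.

(** * The normal law, its tails and the Mills ratio *)

Section normal_integrals.
Context {R : realType} (s : R).
Hypothesis s0 : 0 < s.
Local Notation phi := (normal_pdf 0 s).
Local Notation mu := (@lebesgue_measure R).

Let sN0 : s != 0. Proof. by rewrite gt_eqF. Qed.

Lemma normal_pdf0E x : phi x = normal_peak s * expR (- (2 * s ^+ 2)^-1 * x ^+ 2).
Proof.
rewrite normal_pdfE// /normal_fun subr0; congr (_ * expR _).
by rewrite -[s ^+ 2 *+ 2]mulr_natl mulNr mulrC mulNr.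
Qed.

Lemma normal_pdf_gt0 x : 0 < phi x.
Proof. by rewrite normal_pdf0E mulr_gt0 ?normal_peak_gt0 ?expR_gt0. Qed.

Lemma normal_pdfN x : phi (- x) = phi x.
Proof. by rewrite !normal_pdf0E sqrrN. Qed.

Lemma C1_expR_sqr (a : R) : continuously_differentiable
  (fun x => expR (a * x ^+ 2)) (fun x => 2 * a * x * expR (a * x ^+ 2)).
Proof.
have Ce : continuously_differentiable (@expR R) (@expR R).
  by split; [exact: is_derive_expR|exact: continuous_expR].
apply: (eq_C1 (C1_comp Ce (C1Z a (C1M C1_id C1_id)))) => x //.
by rewrite -expr2; ring.
Qed.

Lemma C1_normal_pdf :
  continuously_differentiable phi (fun x => - x / s ^+ 2 * phi x).
Proof.
apply: (eq_C1 (C1Z (normal_peak s) (C1_expR_sqr (- (2 * s ^+ 2)^-1)))) => x.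
  by rewrite normal_pdf0E.
by rewrite normal_pdf0E; field.
Qed.

Lemma C1_normal_pdfV :
  continuously_differentiable (fun x => (phi x)^-1) (fun x => x / s ^+ 2 / phi x).
Proof.
have pE x : phi x = normal_peak s / expR ((2 * s ^+ 2)^-1 * x ^+ 2).
  by rewrite normal_pdf0E mulNr expRN.
have pN : normal_peak s != 0 by rewrite gt_eqF// normal_peak_gt0.
have eN x : expR ((2 * s ^+ 2)^-1 * x ^+ 2) != 0 by rewrite gt_eqF// expR_gt0.
apply: (eq_C1 (C1Z (normal_peak s)^-1 (C1_expR_sqr (2 * s ^+ 2)^-1))) => x.
  rewrite pE; move: (normal_peak s) pN (expR _) (eN x) => p pN e e0; field.
  by rewrite pN e0.
rewrite pE; move: (normal_peak s) pN (expR _) (eN x) => p pN e e0; field.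
by rewrite pN e0.
Qed.

Lemma integrable_mul_normal_pdf (j : R -> R) (A : set (measurableTypeR R)) :
  measurable A ->
  continuous j -> (forall x, `|j x| <= 1) ->
  mu.-integrable A (EFin \o (fun x => j x * phi x)).
Proof.
move=> mA cj j1; apply: (integrableS measurableT mA) => //.
apply: (@le_integrable _ (measurableTypeR R) R mu setT measurableT _
  (fun x => (phi x)%:E)) => //.
- apply/measurable_EFinP; apply: measurable_funM.
    exact: continuous_measurable_fun.
  exact: measurable_normal_pdf.
- move=> x _; rewrite /= lee_fin normrM ler_piMl//.
- exact: integrable_normal_pdf.
Qed.

Definition normal_integral (j : R -> R) (x : R) : R :=
  \int[mu]_(t in `]-oo, x]) (j t * phi t).

Lemma normal_integralE x :
  normal_integral (fun=> 1) x = fine (normal_prob 0 s `]-oo, x]).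
Proof. by congr fine; apply: eq_integral => t _; rewrite mul1r. Qed.

Lemma C1_normal_integral (j : R -> R) : continuous j -> (forall x, `|j x| <= 1) ->
  continuously_differentiable (normal_integral j) (fun x => j x * phi x).
Proof.
move=> cj j1; have c x : {for x, continuous (fun t => j t * phi t)}.
  apply: cvgM; first exact: cj.
  exact: continuous_normal_pdf.
split; last exact: c.
move=> x; have x1 : x < x + 1 by rewrite ltrDl.
have := @continuous_FTC1 R (fun t => j t * phi t) -oo%O x (x + 1) x1
  (integrable_mul_normal_pdf (measurable_itv _) cj j1).
move=> /(_ _ (c x))[|dx ex]; first by rewrite ltNyr.
by apply: DeriveDef => //; rewrite -derive1E.
Qed.

Lemma norm_normal_integral_le (j : R -> R) x : continuous j ->
  (forall x, `|j x| <= 1) -> `|normal_integral j x| <= normal_integral (fun=> 1) x.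
Proof.
move=> cj j1; have c1 : continuous (fun _ : R => 1 : R) by move=> y; exact: cvg_cst.
have i1 := integrable_mul_normal_pdf (measurable_itv `]-oo, x]) cj j1.
apply: le_trans (le_normr_Rintegral _ i1) _ => //.
apply: le_Rintegral => //.
- exact: integrable_norm i1.
- by apply: integrable_mul_normal_pdf => // y; rewrite normr1.
- by move=> y _; rewrite normrM ler_pM// [`|phi _|]ger0_norm// normal_pdf_ge0.
Qed.

Definition normal_mean (j : R -> R) : R := \int[mu]_t (j t * phi t).

Lemma normal_mean1 : normal_mean (fun=> 1) = 1.
Proof.
rewrite /normal_mean /Rintegral; under eq_integral do rewrite mul1r.
by rewrite integral_normal_pdf.
Qed.

Lemma normal_mean_tail (j : R -> R) x : continuous j -> (forall x, `|j x| <= 1) ->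
  normal_mean j - normal_integral j x = \int[mu]_(t in `]x, +oo[) (j t * phi t).
Proof.
move=> cj j1; rewrite /normal_mean -set_itvNyy Rintegral_itvB//.
exact: integrable_mul_normal_pdf.
Qed.

Lemma norm_normal_tail_le (j : R -> R) x : continuous j ->
  (forall x, `|j x| <= 1) ->
  `|normal_mean j - normal_integral j x| <= 1 - normal_integral (fun=> 1) x.
Proof.
move=> cj j1; have c1 : continuous (fun _ : R => 1 : R) by move=> y; exact: cvg_cst.
have i1 := integrable_mul_normal_pdf (measurable_itv `]x, +oo[) cj j1.
rewrite -[X in X - normal_integral (fun=> 1) x]normal_mean1.
rewrite !normal_mean_tail//; last by move=> y; rewrite normr1.
apply: le_trans (le_normr_Rintegral _ i1) _ => //.
apply: le_Rintegral => //.
- exact: integrable_norm i1.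
- by apply: integrable_mul_normal_pdf => // y; rewrite normr1.
- by move=> y _; rewrite normrM ler_pM// [`|phi _|]ger0_norm// normal_pdf_ge0.
Qed.

(** The identity as a random variable of law [normal_prob 0 s]: its [cdf] is [normal_integral],
    which thus inherits the limits of a distribution function. *)
Let idTR : measurableTypeR R -> R := idfun.

#[local] HB.instance Definition _ :=
  @isMeasurableFun.Build _ _ _ _ idTR (@measurable_id _ _ setT).

Let cdfE : (fun x => (normal_integral (fun=> 1) x)%:E) =
  cdf (idTR : {RV normal_prob 0 s >-> R}).
Proof.
apply/funext => x; rewrite normal_integralE fineK//.
by rewrite fin_num_measure.
Qed.

Lemma normal_integral_cvgy (e : R) : 0 < e ->
  exists A, forall x, A <= x -> 1 - normal_integral (fun=> 1) x <= e.
Proof.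
move=> e0.
have := cvg_cdfy1 (idTR : {RV normal_prob 0 s >-> R}).
rewrite -cdfE => /fine_cvg /cvgrPdist_le /(_ e e0)[A [_ /= AP]].
exists (A + 1) => x Ax; apply: le_trans (ler_norm _) _; apply: AP.
by rewrite (lt_le_trans _ Ax)// ltrDl.
Qed.

Lemma normal_integral_cvgNy (e : R) : 0 < e ->
  exists A, forall x, x <= A -> normal_integral (fun=> 1) x <= e.
Proof.
move=> e0.
have := cvg_cdfNy0 (idTR : {RV normal_prob 0 s >-> R}).
rewrite -cdfE => /fine_cvg /cvgrPdist_le /(_ e e0)[A [_ /= AP]].
exists (A - 1) => x Ax; apply: le_trans (ler_norm _) _.
rewrite -normrN -sub0r; apply: AP.
by rewrite (le_lt_trans Ax)// ltrBlDr ltrDl.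
Qed.

End normal_integrals.

(** * Tail comparison and Stein's equation for the normal law *)

Section tail_comparison.
Context {R : realType} (s : R).
Hypothesis s0 : 0 < s.
Local Notation phi := (normal_pdf 0 s).

Definition vanishes_at_infinity (H : R -> R) : Prop :=
  forall e, 0 < e -> exists A, forall x, A <= x -> `|H x| <= e.

Lemma nonincreasing_vanishing_ge (g dg H : R -> R) (w : R) :
  (forall x : R, w <= x -> is_derive x 1 g (dg x)) -> (forall x, w <= x -> dg x <= 0) ->
  (forall x, w <= x -> - `|H x| <= g x) -> vanishes_at_infinity H -> 0 <= g w.
Proof.
move=> gd dg0 gH H0; rewrite -oppr_le0; apply/ler_addgt0Pr => e e0; rewrite add0r.
have [A AP] := H0 _ e0; pose b := Num.max A w.
have wb : w <= b by rewrite le_max lexx orbT.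
have [c /andP[wc _] e1] : exists2 c, w <= c <= b & g b - g w = dg c * (b - w).
  by apply: MVT_le => // x /andP[wx _]; exact: gd.
have : g b - g w <= 0 by rewrite e1 mulr_le0_ge0 ?subr_ge0// dg0.
have := gH _ wb; have := AP b; rewrite le_max lexx /= => /(_ isT); lra.
Qed.

(** The function [s^2 phi(x) / x] has derivative [- phi(x) - s^2 phi(x) / x^2], so it decreases at
    least as fast as [H] or [- H] can, and subtracting either leaves a nonincreasing function. This
    yields both the upper bound on the Mills ratio and the boundedness of Stein solutions. *)
Lemma normal_tail_comparison (H dH : R -> R) (w : R) :
  (forall x : R, is_derive x 1 H (dH x)) ->
  (forall x, 0 <= x -> `|dH x| <= phi x) ->
  vanishes_at_infinity H -> 0 <= w -> `|w * H w| <= s ^+ 2 * phi w.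
Proof.
move=> Hd Hphi H0; rewrite le_eqVlt => /predU1P[<-|w0].
  by rewrite mul0r normr0 mulr_ge0 ?sqr_ge0// normal_pdf_ge0.
have main (S : R) : `|S| = 1 -> 0 <= s ^+ 2 * phi w * w^-1 - S * H w.
  move=> S1; have [pd _] := C1_normal_pdf s0.
  apply: (@nonincreasing_vanishing_ge (fun x => s ^+ 2 * phi x * x^-1 - S * H x)
    (fun x => - phi x - s ^+ 2 * phi x * x ^- 2 - S * dH x) H w) => //.
  - move=> x wx; have x0 : x != 0 by rewrite gt_eqF// (lt_le_trans w0).
    have d1 := @is_deriveV R id x 1 1 x0 (is_derive_id _ _).
    have d2 := is_deriveM (is_deriveZ (s ^+ 2) (pd x)) d1.
    have d3 := is_deriveB d2 (is_deriveZ S (Hd x)).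
    apply: (is_derive_eq d3).
    transitivity (s ^+ 2 * phi x * (- x ^- 2 * 1)
      + x^-1 * (s ^+ 2 * (- x / s ^+ 2 * phi x)) - S * dH x); first by [].
    by field; rewrite x0 gt_eqF.
  - move=> x wx; have x0 : 0 <= x by rewrite (le_trans (ltW w0)).
    have : `|S * dH x| <= phi x by rewrite normrM S1 mul1r Hphi.
    rewrite ler_norml => /andP[h _].
    have : 0 <= s ^+ 2 * phi x * x ^- 2.
      by rewrite mulr_ge0 ?invr_ge0 ?sqr_ge0// mulr_ge0 ?sqr_ge0 ?normal_pdf_ge0.
    lra.
  - move=> x wx; have x0 : 0 <= x by rewrite (le_trans (ltW w0)).
    have : S * H x <= `|H x| by rewrite -[leRHS]mul1r -S1 -normrM ler_norm.
    have : 0 <= s ^+ 2 * phi x * x^-1.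
      by rewrite mulr_ge0 ?invr_ge0// mulr_ge0 ?sqr_ge0 ?normal_pdf_ge0.
    lra.
rewrite normrM (gtr0_norm w0) mulrC -ler_pdivlMr// ler_norml.
have := main 1 (normr1 _); have := main (-1) (normrN1 _).
by rewrite mulN1r mul1r => h1 h2; apply/andP; split; lra.
Qed.

End tail_comparison.

Section stein_solution.
Context {R : realType} (s : R).
Hypothesis s0 : 0 < s.
Local Notation phi := (normal_pdf 0 s).
Variable k : R -> R.
Hypotheses (ck : continuous k) (k0 : forall x, 0 <= k x) (k1 : forall x, k x <= 1).

(** The integrating factor [phi] gives [f = H / (s^2 phi)], with [H] the integral of [(k - c) phi]
    up to [x]. Once [|x f x| <= 1], the equation itself bounds [s^2 df = x f + k - c] by [2]. *)
Lemma stein_solution : exists f df : R -> R,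
  [/\ continuously_differentiable f df,
      (exists D, forall x, `|df x| <= D) &
      forall x, x * f x - s ^+ 2 * df x = normal_mean s k - k x].
Proof.
have knorm x : `|k x| <= 1 by rewrite ger0_norm.
set c := normal_mean s k.
have c0 : 0 <= c by apply: Rintegral_ge0 => x _; rewrite mulr_ge0 ?normal_pdf_ge0.
have i1 j := @integrable_mul_normal_pdf R s j setT (@measurableT _ (measurableTypeR R)).
have c1 : c <= 1.
  rewrite -(normal_mean1 s); apply: le_Rintegral => //.
  - exact: i1.
  - by apply: i1 => [x|x]; [exact: cvg_cst|rewrite normr1].
  - by move=> x _; rewrite ler_wpM2r ?normal_pdf_ge0.
pose j x := k x - c.
have cj : continuous j by move=> x; apply: cvgB; [exact: ck|exact: cvg_cst].
have j1 x : `|j x| <= 1 by rewrite ler_norml /j; have := k0 x; have := k1 x; lra.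
have j0 : normal_mean s j = 0.
  have i1k := i1 _ ck knorm.
  have i11 : lebesgue_measure.-integrable setT (EFin \o (fun x => 1 * phi x)).
    by apply: i1 => [x|x]; [exact: cvg_cst|rewrite normr1].
  transitivity (\int[lebesgue_measure]_x (k x * phi x - c * (1 * phi x))).
    by apply: eq_Rintegral => x _; rewrite /j mul1r mulrBl.
  rewrite RintegralB//; last by have := integrableZl _ c i11; exact.
  by rewrite RintegralZl// -/(normal_mean s (fun=> 1)) normal_mean1 mulr1 subrr.
pose H := normal_integral s j.
have CH : continuously_differentiable H (fun x => j x * phi x).
  exact: C1_normal_integral.
have [Hd _] := CH.
have jphi x : `|j x * phi x| <= phi x.
  by rewrite normrM [`|phi x|]ger0_norm ?normal_pdf_ge0// ler_piMl// normal_pdf_ge0.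
(* By [j0] the function [H] vanishes at both ends. The comparison applies directly for [x >= 0], and
   to the reflection of [H] for [x < 0]. *)
have bound x : `|x * H x| <= s ^+ 2 * phi x.
  have [x0|x0] := leP 0 x.
    apply: (normal_tail_comparison s0 Hd) => // e e0.
    have [A AP] := normal_integral_cvgy s e0; exists A => y /AP.
    apply: le_trans; rewrite -normrN -sub0r -j0.
    exact: norm_normal_tail_le.
  have CN := C1_comp CH (C1Z (-1) C1_id).
  have [Nd _] := CN.
  suff : `|- x * H (-1 * - x)| <= s ^+ 2 * phi (- x).
    by rewrite mulrNN mul1r mulNr normrN normal_pdfN.
  apply: (normal_tail_comparison s0 Nd).
  - move=> y y0; rewrite mulr1 normrM normrN1 mulr1.
    by rewrite (le_trans (jphi _))// mulN1r normal_pdfN.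
  - move=> e e0; have [A AP] := normal_integral_cvgNy s e0; exists (- A) => y yA.
    rewrite mulN1r; apply: le_trans (norm_normal_integral_le _ _ _ _) _ => //.
    by apply: AP; rewrite lerNl.
  - by rewrite oppr_ge0 ltW.
have CV := C1_normal_pdfV s0.
pose f x := (s ^+ 2)^-1 * (H x * (phi x)^-1).
pose df x := (s ^+ 2)^-1 * (j x * phi x * (phi x)^-1 + H x * (x / s ^+ 2 / phi x)).
have pN x : phi x != 0 by rewrite gt_eqF// normal_pdf_gt0.
have sN : s != 0 by rewrite gt_eqF.
have eq x : x * f x - s ^+ 2 * df x = c - k x.
  by rewrite /f /df /j; field; rewrite pN sN.
exists f, df; split => //.
- exact: C1Z (C1M CH CV).
- exists (2 / s ^+ 2) => x.
  have xf : `|x * f x| <= 1.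
    rewrite (_ : x * f x = x * H x / (s ^+ 2 * phi x)); last first.
      by rewrite /f; field; rewrite pN sN.
    have sp : 0 < s ^+ 2 * phi x by rewrite mulr_gt0 ?exprn_gt0// normal_pdf_gt0.
    by rewrite normrM normfV (gtr0_norm sp) ler_pdivrMr// mul1r.
  rewrite ler_pdivlMr ?exprn_gt0// -[s ^+ 2]gtr0_norm ?exprn_gt0// -normrM mulrC.
  have -> : s ^+ 2 * df x = x * f x + j x by rewrite /j; have := eq x; lra.
  by rewrite (le_trans (ler_normD _ _))// (_ : 2 = 1 + 1)// lerD.
Qed.

End stein_solution.

(** * The Mills ratio and explicit Stein solutions on the half-line *)

Section mills_ratio.
Context {R : realType}.
Local Notation phi := (normal_pdf 0 1 : R -> R).
Local Notation Phi := (normal_integral 1 (fun=> 1) : R -> R).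

Definition abs_normal_mean : R := Num.sqrt (2 / pi).
Local Notation m := abs_normal_mean.

Definition mills (x : R) : R := (1 - Phi x) / phi x.
Local Notation M := mills.

Let c1 : continuous (fun _ : R => 1 : R). Proof. by move=> x; exact: cvg_cst. Qed.
Let n1 (x : R) : `|1 : R| <= 1. Proof. by rewrite normr1. Qed.
Let phiN0 x : phi x != 0. Proof. by rewrite gt_eqF// normal_pdf_gt0. Qed.

Lemma sqr_abs_normal_mean : m ^+ 2 = 2 / pi.
Proof. by rewrite sqr_sqrtr// divr_ge0// pi_ge0. Qed.

Lemma abs_normal_mean_gt0 : 0 < m.
Proof. by rewrite sqrtr_gt0 divr_gt0// pi_gt0. Qed.

Lemma abs_normal_mean_le1 : m <= 1.
Proof.
rewrite -[leRHS]sqrtr1 ler_wsqrtr// ler_pdivrMr ?pi_gt0// mul1r; exact: pi_ge2.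
Qed.

Lemma abs_normal_meanE : m = 2 * phi 0.
Proof.
apply/eqP; rewrite -(@eqrXn2 _ 2)//; last 2 first.
- exact: sqrtr_ge0.
- by rewrite mulr_ge0// normal_pdf_ge0.
rewrite sqr_abs_normal_mean normal_pdf0E// expr0n mulr0 expR0 mulr1 exprMn.
rewrite /normal_peak exprVn sqr_sqrtr; last first.
  by rewrite mulrn_wge0// mulr_ge0 ?sqr_ge0// pi_ge0.
have piN : (pi : R) != 0 by rewrite gt_eqF// pi_gt0.
apply/eqP; rewrite expr1n mul1r -[pi *+ 2]mulr_natl; move: (pi : R) piN => p pN; field.
exact: pN.
Qed.

Lemma normal_integral0 : Phi 0 = 2^-1.
Proof.
have c x : {for x, continuous (fun t : R => 1 * phi t)}.
  by apply: cvgM; [exact: cvg_cst|exact: continuous_normal_pdf].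
have e : (fun t : R => 1 * phi t) =1 (fun t => 1 * phi t) \o -%R.
  by move=> x /=; rewrite normal_pdfN.
have p x : 0 <= 1 * phi x by rewrite mul1r normal_pdf_ge0.
have := ge0_symfun_integralT p c e.
have -> : (\int[lebesgue_measure]_x (1 * phi x)%:E = 1)%E.
  by under eq_integral do rewrite mul1r; exact: integral_normal_pdf.
rewrite -set_itvcy => /(congr1 fine); rewrite fineM//; last first.
  by apply: integrable_fin_num => //; exact: integrable_mul_normal_pdf.
have := normal_mean_tail 1 0 c1 n1.
rewrite normal_mean1 Rintegral_itv_obnd_cbnd; last first.
  exact: integrable_mul_normal_pdf.
by rewrite /Rintegral /= => <-; lra.
Qed.

Let T x : R := 1 - Phi x.

Let T_vanishes : vanishes_at_infinity T.
Proof.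
move=> e e0; have [A AP] := normal_integral_cvgy 1 e0; exists A => x /AP.
apply: le_trans; rewrite /T ger0_norm//.
by apply: le_trans (norm_normal_tail_le 1 x c1 n1); exact: normr_ge0.
Qed.

Let CT : continuously_differentiable T (fun x => - phi x).
Proof.
apply: (eq_C1 (C1B (C1_cst 1) (C1_normal_integral ltr01 c1 n1))) => // x.
by rewrite sub0r mul1r.
Qed.

Let T_ge0 x : 0 <= T x.
Proof. by apply: le_trans (norm_normal_tail_le 1 x c1 n1); exact: normr_ge0. Qed.

Lemma mills_ge0 x : 0 <= M x.
Proof. by rewrite divr_ge0// ?T_ge0// normal_pdf_ge0. Qed.

Lemma C1_mills : continuously_differentiable M (fun x => x * M x - 1).
Proof.
apply: (eq_C1 (C1M CT (C1_normal_pdfV ltr01))) => // x.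
by rewrite /mills /T; field.
Qed.

Lemma mills_ub x : 0 <= x -> x * M x <= 1.
Proof.
move=> x0; have [Td _] := CT.
have := normal_tail_comparison ltr01 Td _ T_vanishes x0.
rewrite expr1n mul1r ger0_norm; last by rewrite mulr_ge0// T_ge0.
rewrite /mills mulrA ler_pdivrMr ?normal_pdf_gt0// mul1r; apply.
by move=> y _; rewrite normrN ger0_norm// normal_pdf_ge0.
Qed.

(** The normal tail minus [phi(x) x / (1 + x^2)] has derivative [- 2 phi(x) / (1 + x^2)^2] and
    vanishes at infinity, so it is nonnegative. *)
Lemma mills_lb x : 0 <= x -> x <= (1 + x ^+ 2) * M x.
Proof.
move=> x0; have q0 (y : R) : 0 < 1 + y ^+ 2 by rewrite ltr_pwDl// sqr_ge0.
have [pd _] := C1_normal_pdf (ltr01 : 0 < 1 :> R); have [Td _] := CT.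
have : 0 <= T x - phi x * (x * (1 + x ^+ 2)^-1).
  apply: (@nonincreasing_vanishing_ge R (fun x => T x - phi x * (x * (1 + x ^+ 2)^-1))
    (fun x => - 2 * phi x / (1 + x ^+ 2) ^+ 2)
    (fun x => phi x * (x * (1 + x ^+ 2)^-1))).
  - move=> y _; have qN : 1 + y ^+ 2 != 0 by rewrite gt_eqF.
    have [qd _] : continuously_differentiable (fun x : R => 1 + x ^+ 2) (fun x => 2 * x).
      apply: (eq_C1 (C1D (C1_cst 1) (C1M C1_id C1_id))) => z.
        by rewrite expr2.
      by ring.
    have d1 := @is_deriveV R (fun x => 1 + x ^+ 2) y _ _ qN (qd y).
    have d2 := is_deriveB (Td y) (is_deriveM (pd y) (is_deriveM (is_derive_id _ _) d1)).
    apply: (is_derive_eq d2).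
    transitivity (- phi y - (phi y * (y * (- (1 + y ^+ 2) ^- 2 * (2 * y))
      + (1 + y ^+ 2)^-1 * 1) + y / (1 + y ^+ 2) * (- y / 1 ^+ 2 * phi y))); first by [].
    by field.
  - move=> y _; rewrite -mulrA mulNr oppr_le0 mulr_ge0// divr_ge0 ?sqr_ge0//.
    exact: normal_pdf_ge0.
  - by move=> y _; rewrite (le_trans (_ : _ <= - (phi y * (y * (1 + y ^+ 2)^-1))))
      ?lerN2 ?ler_norm// lerBrDl subrr T_ge0.
  - move=> e e0; exists (Num.max 1 (normal_peak 1 / e)) => y.
    rewrite ge_max => /andP[y1 ye]; have y0 : 0 < y by rewrite (lt_le_trans ltr01).
    rewrite ger0_norm; last first.
      by rewrite mulr_ge0 ?normal_pdf_ge0// mulr_ge0 ?ltW// invr_gt0.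
    apply: (@le_trans _ _ (normal_peak 1 * y^-1)).
      rewrite ler_pM ?normal_pdf_ge0 ?normal_pdf_ub ?oner_neq0//.
        by rewrite mulr_ge0 ?ltW// invr_gt0.
      by rewrite ler_pdivrMr// ler_pdivlMl// -expr2 lerDr.
    by rewrite ler_pdivrMr// mulrC -ler_pdivrMr.
rewrite subr_ge0 mulrA ler_pdivrMr// => h.
by rewrite /mills mulrA ler_pdivlMr ?normal_pdf_gt0// mulrC (le_trans h)// mulrC.
Qed.

Lemma mills0 : m * M 0 = 1.
Proof. by rewrite /mills normal_integral0 abs_normal_meanE; field. Qed.

Lemma mills_le x : 0 <= x -> m * M x <= 1.
Proof.
move=> x0; rewrite -mills0 ler_wpM2l ?(ltW abs_normal_mean_gt0)//.
have [Md _] := C1_mills.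
have [y /andP[y0 _] e] := MVT_le x0 (fun x _ => Md x).
by rewrite -subr_le0 e subr0 mulr_le0_ge0// subr_le0 mills_ub.
Qed.

(* On [x >= 0], the solution of [g' x - x * g x = x - m] vanishing at [0]. *)
Definition stein_abs (x : R) := m * M x - 1.
Definition stein_abs' (x : R) := m * (x * M x - 1).

Let CM' : continuously_differentiable (fun x => x * M x - 1)
  (fun x => M x + x * (x * M x - 1)).
Proof.
apply: (eq_C1 (C1B (C1M C1_id C1_mills) (C1_cst 1))) => // x.
by rewrite mul1r subr0.
Qed.

Lemma C1_stein_abs : continuously_differentiable stein_abs stein_abs'.
Proof.
by apply: (eq_C1 (C1B (C1Z m C1_mills) (C1_cst 1))) => // x; rewrite subr0.
Qed.

Lemma stein_pair_abs : stein_pair stein_abs stein_abs' id (fun=> 1) m 3.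
Proof.
have [m0 m1] := (abs_normal_mean_gt0, abs_normal_mean_le1).
split => [|||x x0|x x0|x _].
- by rewrite /stein_abs mills0 subrr.
- exact: C1_stein_abs.
- exact: C1_id.
- by rewrite /stein_abs /stein_abs' /=; ring.
- rewrite /stein_abs' normrM (gtr0_norm m0).
  have := mills_ub x0; have : 0 <= x * M x by rewrite mulr_ge0 ?mills_ge0.
  move=> h1 h2; rewrite ler0_norm ?subr_le0//; nra.
- by rewrite normr1; lra.
Qed.

(** Here [u = - M'], and [mills_lb] amounts to [(1 + x^2) u <= 1] for [x >= 0]. The derivatives of
    the Stein solutions below are combinations of these quantities, [m M] and [m x M], which
    explains the common bound [3]. *)
Let mills_u x : 0 <= x -> let u := 1 - x * M x in
  [/\ 0 <= m * u <= 1, 0 <= m * (x * u) <= 1 & 0 <= m * (x ^+ 2 * u) <= 1].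
Proof.
move=> x0 u; have [m0 m1] := (abs_normal_mean_gt0, abs_normal_mean_le1).
have u0 : 0 <= u by rewrite subr_ge0 mills_ub.
have xM : 0 <= x * M x by rewrite mulr_ge0 ?mills_ge0.
have u1 : u <= 1 by rewrite /u; lra.
have x2u : (1 + x ^+ 2) * u <= 1.
  have : x * x <= x * ((1 + x ^+ 2) * M x) by rewrite ler_wpM2l// mills_lb.
  by rewrite /u; nra.
have xu : x * u <= 1.
  apply: le_trans x2u; rewrite ler_wpM2r//; have := sqr_ge0 (x - 1); nra.
have xu0 : 0 <= x * u by rewrite mulr_ge0.
have x2u0 : 0 <= x ^+ 2 * u by rewrite mulr_ge0 ?sqr_ge0.
have a y : 0 <= y -> y <= 1 -> 0 <= m * y <= 1.
  by move=> y0 y1; apply/andP; split; [rewrite mulr_ge0// ltW|rewrite mulr_ile1// ltW].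
by split; apply: a => //; lra.
Qed.

(** For the operator [A y = y' - x y] one has [A M = -1] and [A M' = M], where [M' = x M - 1]. Thus
    [m M' + a M] is sent to [m M - a], and vanishing at [0] forces [a = m^2] because
    [m M(0) = 1]. *)
Lemma stein_pair_stein_abs : exists ga dga,
  stein_pair ga dga stein_abs stein_abs' (- (1 - m ^+ 2)) 3.
Proof.
have [m0 m1] := (abs_normal_mean_gt0, abs_normal_mean_le1).
exists (fun x => m * (x * M x - 1) + m ^+ 2 * M x).
exists (fun x => m * (M x + x * (x * M x - 1)) + m ^+ 2 * (x * M x - 1)).
split => [|||x x0|x x0|x x0].
- by rewrite mul0r sub0r expr2 -mulrA mills0 mulr1 mulrN1 addNr.
- exact: C1D (C1Z m CM') (C1Z (m ^+ 2) C1_mills).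
- exact: C1_stein_abs.
- by rewrite /stein_abs; ring.
- have [/andP[u1 u2] /andP[u4 u3] /andP[u5 u6]] := mills_u x0.
  have := mills_le x0; have := mills_ge0 x => M0 M1.
  have := mulr_ge0 (ltW m0) M0.
  have -> : m * (M x + x * (x * M x - 1)) + m ^+ 2 * (x * M x - 1) =
    m * M x - m * (x * (1 - x * M x)) - m * (m * (1 - x * M x)) by ring.
  have : m * (m * (1 - x * M x)) <= 1 by rewrite mulr_ile1// ltW.
  have : 0 <= m * (m * (1 - x * M x)) by rewrite mulr_ge0// ltW.
  by move=> *; rewrite ler_norml; apply/andP; split; lra.
- exact: stein_dg stein_pair_abs _ x0.
Qed.

(** With the same operator, [A (x M') = 2 x M - 1] and [A] sends [stein_abs] to [x - m]. Hence
    [(m / 2) x M' - stein_abs], which vanishes at [0], is sent to [x (m M - 1) + m / 2]. *)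
Lemma stein_pair_id_stein_abs : exists gb dgb,
  stein_pair gb dgb (fun x => x * stein_abs x)
    (fun x => stein_abs x + x * stein_abs' x) (- (m / 2)) 3.
Proof.
have [m0 m1] := (abs_normal_mean_gt0, abs_normal_mean_le1).
exists (fun x => m / 2 * (x * (x * M x - 1)) - (m * M x - 1)).
exists (fun x => m / 2 * (1 * (x * M x - 1) + x * (M x + x * (x * M x - 1)))
                 - (m * (x * M x - 1))).
split => [|||x x0|x x0|x x0].
- by rewrite mul0r mulr0 mills0 subrr subr0.
- exact: C1B (C1Z (m / 2) (C1M C1_id CM')) C1_stein_abs.
- by apply: (eq_C1 (C1M C1_id C1_stein_abs)) => // x; rewrite mul1r.
- by rewrite /stein_abs; field.
- have [/andP[u1 u2] /andP[u4 u3] /andP[u5 u6]] := mills_u x0.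
  have := mills_ub x0; have : 0 <= x * M x by rewrite mulr_ge0 ?mills_ge0.
  move=> h1 h2; have h3 : m * (x * M x) <= 1 by rewrite mulr_ile1// ltW.
  have h4 : 0 <= m * (x * M x) by rewrite mulr_ge0// ltW.
  by rewrite ler_norml; apply/andP; split; lra.
- have [/andP[u1 u2] /andP[u4 u3] /andP[u5 u6]] := mills_u x0.
  have := mills_le x0; have := mulr_ge0 (ltW m0) (mills_ge0 x).
  by rewrite /stein_abs /stein_abs' => h1 h2; rewrite ler_norml; apply/andP; split; lra.
Qed.

End mills_ratio.

(** * The width of the cube and the limit theorem *)

Section pi_bound.
Context {R : realType}.

Lemma sin_lt_id (x : R) : 0 < x < pi / 2 -> sin x < x.
Proof.
move=> /andP[x0 xpi].
have cs : {within `[0, x], continuous (@sin R)}.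
  by apply: continuous_subspaceT => y; exact: continuous_sin.
have [c] := MVT x0 (fun y _ => is_derive_sin y) cs.
rewrite in_itv/= => /andP[c0 cx].
rewrite sin0 !subr0 => ->; rewrite gtr_pMl// lt_neqAle cos_le1 andbT.
apply/eqP => c1; have := sin_gt0_pihalf (x := c).
rewrite c0 (lt_trans cx xpi) => /(_ isT); rewrite cos1sin0 ?ltxx//.
by rewrite c1 normr1.
Qed.

(** Tripling the angle gives [3 t - 4 t^3 = 1], that is [(t + 1) (2 t - 1)^2 = 0], and [t > 0]
    excludes the root [-1]. *)
Lemma sin_pi_sixth : sin (pi / 6) = 2^-1 :> R.
Proof.
set x : R := pi / 6; set t := sin x.
have x0 : 0 < x < pi / 2 by rewrite /x; have := @pi_gt0 R; lra.
have t0 : 0 < t by exact: sin_gt0_pihalf.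
have : sin (x + (x + x)) = 1.
  by rewrite (_ : x + (x + x) = pi / 2) ?sin_pihalf// /x; lra.
rewrite sinD sinD cosD -!expr2 -/t.
have := cos2Dsin2 x; rewrite -/t; move: (cos x) => c h e.
have {}e : 3 * t - 4 * t ^+ 3 = 1.
  have c2 : c ^+ 2 = 1 - t ^+ 2 by rewrite -h addrK.
  apply: eq_trans e.
  transitivity (t * (c ^+ 2 - t ^+ 2) + 2 * t * c ^+ 2); last by ring.
  by rewrite c2; ring.
have : (t + 1) * (2 * t - 1) ^+ 2 = 0.
  by have -> : (t + 1) * (2 * t - 1) ^+ 2 = 1 - (3 * t - 4 * t ^+ 3);
    [ring|rewrite e subrr].
move=> /eqP; rewrite mulf_eq0 sqrf_eq0 => /orP[]/eqP; lra.
Qed.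

Lemma pi_gt3 : 3 < pi :> R.
Proof.
have := @sin_lt_id (pi / 6); rewrite sin_pi_sixth.
have := @pi_gt0 R => p0 h; suff : 2^-1 < pi / 6 :> R by lra.
by apply: h; lra.
Qed.

End pi_bound.

Section width_of_the_cube.
Context {R : realType} {n : nat}.
Implicit Types u t : 'rV[R]_n.

Lemma norm_inner_cube_le u t : cube t -> `|inner u t| <= 2^-1 * \sum_(i < n) `|u ord0 i|.
Proof.
move=> tQ; rewrite (le_trans (ler_norm_sum _ _ _))// mulr_sumr ler_sum// => i _.
by rewrite normrM mulrC ler_wpM2r// ler_norml; exact: tQ.
Qed.

(** The values [a = 1 / 2] and [a = - 1 / 2] give points where the supremum and the infimum over the
    cube are attained. *)
Lemma inner_cube_sg u (a : R) : `|a| = 2^-1 -> exists2 t, cube t &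
  inner u t = a * \sum_(i < n) `|u ord0 i|.
Proof.
move=> aE; exists (\row_i (a * Num.sg (u ord0 i))).
  move=> i; rewrite mxE -ler_norml normrM aE normr_sg ler_piMr//.
  by case: (_ != _).
rewrite /inner mulr_sumr; apply: eq_bigr => i _.
by rewrite mxE mulrCA (mulrC (u ord0 i)) -normrEsg.
Qed.

Lemma width_cube u : width (@cube R n) u = \sum_(i < n) `|u ord0 i|.
Proof.
rewrite /width; set S := \sum_(i < n) _; set A := [set inner u t | t in _].
have h2 : `|2^-1| = 2^-1 :> R by rewrite ger0_norm.
have [t tQ tE] := inner_cube_sg u h2.
have [v vQ vE] := inner_cube_sg u (etrans (normrN _) h2).
have AP x : A x -> - (2^-1 * S) <= x <= 2^-1 * S.
  by move=> [y yQ <-]; rewrite -ler_norml norm_inner_cube_le.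
have At : A (2^-1 * S) by exists t.
have Av : A (- (2^-1 * S)) by exists v => //; rewrite vE mulNr.
have supA : has_sup A.
  by split; [exists (2^-1 * S)|exists (2^-1 * S) => x /AP /andP[]].
have infA : has_inf A.
  by split; [exists (2^-1 * S)|exists (- (2^-1 * S)) => x /AP /andP[]].
have -> : sup A = 2^-1 * S.
  apply/eqP; rewrite eq_le; apply/andP; split.
    by apply: ge_sup; [case: supA|move=> x /AP /andP[]].
  by apply: ub_le_sup => //; case: supA.
have -> : inf A = - (2^-1 * S).
  apply/eqP; rewrite eq_le; apply/andP; split.
    by apply: ge_inf => //; case: infA.
  by apply: lb_le_inf; [case: infA|move=> x /AP /andP[]].
by field.
Qed.

End width_of_the_cube.

Section ramp.
Context {R : realType} (a e : R).
Hypothesis e0 : 0 < e.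

(* Equal to [1] up to [a], to [0] from [a + e] on, and affine in between. *)
Definition ramp (t : R) : R :=
  2^-1 * (`|(a + e - t) / e| - `|(a + e - t) / e - 1| + 1).

Lemma continuous_ramp : continuous ramp.
Proof.
have c (b : R) : continuous (fun t : R => `|(a + e - t) / e - b|).
  move=> t; apply: cvg_norm; apply: cvgB; last exact: cvg_cst.
  apply: cvgM; last exact: cvg_cst.
  by apply: cvgB; [exact: cvg_cst|exact: cvg_id].
move=> t; apply: cvgM; first exact: cvg_cst.
apply: cvgD; last exact: cvg_cst.
apply: cvgB; last exact: c.
have := c 0; rewrite (_ : (fun t : R => `|(a + e - t) / e - 0|) =
  fun t => `|(a + e - t) / e|); last by apply/funext => y; rewrite subr0.
exact.
Qed.

Lemma ramp_ge0 t : 0 <= ramp t.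
Proof.
by rewrite /ramp; set v := _ / e; have := ler_normB v 1; rewrite normr1; lra.
Qed.

Lemma ramp_le1 t : ramp t <= 1.
Proof. by rewrite /ramp; set v := _ / e; have := ler_normD (v - 1) 1; rewrite subrK normr1; lra. Qed.

Lemma ramp_left t : t <= a -> ramp t = 1.
Proof.
move=> ta; rewrite /ramp; have v1 : 1 <= (a + e - t) / e.
  by rewrite ler_pdivlMr// mul1r; lra.
by rewrite ger0_norm 1?ger0_norm; [field; rewrite gt_eqF|lra|lra].
Qed.

Lemma ramp_right t : a + e <= t -> ramp t = 0.
Proof.
move=> ta; rewrite /ramp; have v0 : (a + e - t) / e <= 0.
  by rewrite ler_pdivrMr// mul0r; lra.
by rewrite ler0_norm 1?ler0_norm; [field; rewrite gt_eqF|lra|lra].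
Qed.

Lemma normal_mean_ramp (s : R) :
  normal_integral s (fun=> 1) a <= normal_mean s ramp
    <= normal_integral s (fun=> 1) (a + e).
Proof.
have r1 t : `|ramp t| <= 1 by rewrite ger0_norm ?ramp_le1// ramp_ge0.
apply/andP; split.
  have -> : normal_integral s (fun=> 1) a = normal_integral s ramp a.
    apply: eq_Rintegral => t; rewrite inE/= in_itv/= => ta.
    by rewrite ramp_left.
  rewrite -subr_ge0 (normal_mean_tail s a continuous_ramp r1).
  by apply: Rintegral_ge0 => t _; rewrite mulr_ge0 ?ramp_ge0 ?normal_pdf_ge0.
have -> : normal_mean s ramp = normal_integral s ramp (a + e).
  apply/eqP; rewrite -subr_eq0 (normal_mean_tail s _ continuous_ramp r1).
  apply/eqP; transitivity (\int[lebesgue_measure]_(t in `]a + e, +oo[) (0 : R)).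
    apply: eq_Rintegral => t; rewrite inE/= in_itv/= andbT => ta.
    by rewrite ramp_right ?mul0r// ltW.
  by rewrite Rintegral_cst// mul0r.
by rewrite (le_trans (ler_norm _))// norm_normal_integral_le//; exact: continuous_ramp.
Qed.

End ramp.

Lemma normal_integral_lipschitz {R : realType} (s x e : R) : 0 < s -> 0 <= e ->
  normal_integral s (fun=> 1) (x + e) <=
  normal_integral s (fun=> 1) x + e * normal_peak s.
Proof.
move=> s0 e0; have c1 : continuous (fun _ : R => 1 : R) by move=> y; exact: cvg_cst.
have n1 (y : R) : `|1 : R| <= 1 by rewrite normr1.
have [d _] := C1_normal_integral s0 c1 n1.
have xe : x <= x + e by rewrite lerDl.
have [y _ E] := MVT_le xe (fun y _ => d y).
rewrite -lerBlDl E mul1r (addrC x) addrK mulrC ler_wpM2l//.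
by rewrite normal_pdf_ub// gt_eqF.
Qed.

Section sphere_clt.
Context {R : realType}.
Local Notation m := (@abs_normal_mean R).
Local Notation sigma := (Num.sqrt ((pi - 3) / pi) : R).

Lemma limit_std_gt0 : 0 < sigma.
Proof. by rewrite sqrtr_gt0 divr_gt0 ?pi_gt0// subr_gt0 pi_gt3. Qed.

(** For [Z] standard normal, [1 - m^2] is the variance of [|Z|]; the further [m^2 / 2] removed is
    the part explained by [Z^2], whose sum is constant on the sphere. *)
Lemma sqr_limit_std : m * - (m / 2) - - (1 - m ^+ 2) = sigma ^+ 2.
Proof.
rewrite [RHS]sqr_sqrtr; last by rewrite divr_ge0 ?pi_ge0// subr_ge0 ltW// pi_gt3.
transitivity (1 - 3 / 2 * m ^+ 2); first by field.
rewrite sqr_abs_normal_mean.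
by move: (pi : R) (@pi_gt0 R) => p p0; field; rewrite gt_eqF.
Qed.

Lemma bounded_rv_normalized_sum (d : measure_display) (T : measurableType d)
    (n : nat) (P : probability T R) (U : T -> 'rV[R]_n) :
  uniform_on_sphere P U -> bounded_rv (normalized_sum U m).
Proof.
move=> unifU; apply: bounded_rvM; last exact: bounded_rv_cst.
apply: bounded_rvB; last exact: bounded_rv_cst.
by apply: (bounded_rv_coord_sum unifU) => x; exact: cvg_id.
Qed.

Lemma measurable_normalized_sum_le (d : measure_display) (T : measurableType d)
    (n : nat) (P : probability T R) (U : T -> 'rV[R]_n) (x : R) :
  uniform_on_sphere P U -> measurable [set w | normalized_sum U m w <= x].
Proof.
move=> /bounded_rv_normalized_sum[mW _].
rewrite (_ : mkset _ = normalized_sum U m @^-1` `]-oo, x]); last first.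
  by apply/seteqP; split => w /=; rewrite in_itv.
by rewrite -[X in measurable X]setTI; exact: mW.
Qed.

(** [C] is chosen before [n] and the probability space because it depends on the Stein solution for
    [k] only; this lets the spaces vary with [n]. *)
Lemma mean_normalized_sum_cvg (k : R -> R) : continuous k ->
  (forall x, 0 <= k x) -> (forall x, k x <= 1) -> exists C : R, 0 <= C /\
  forall (d : measure_display) (T : measurableType d) (n : nat)
    (P : probability T R) (U : T -> 'rV[R]_n),
  (0 < n)%N -> uniform_on_sphere P U ->
  `|mean P (fun w => k (normalized_sum U m w)) - normal_mean sigma k|
    <= C / Num.sqrt n%:R.
Proof.
move=> ck k0 k1.
have [f [df [Cf [D dfD] fE]]] := stein_solution limit_std_gt0 ck k0 k1.
have [ga [dga spa]] := @stein_pair_stein_abs R.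
have [gb [dgb spb]] := @stein_pair_id_stein_abs R.
have spp := @stein_pair_abs R.
exists `|stein_bound f (- (m / 2)) 3 D|; split => // d T n P U n0 unifU.
have bW := bounded_rv_normalized_sum unifU.
have := stein_estimate spp spa spb Cf dfD n0 unifU.
rewrite sqr_limit_std; under eq_mean do rewrite fE.
have bk := bounded_rv_comp ck bW.
rewrite meanB//; last exact: bounded_rv_cst.
rewrite mean_cst distrC => /le_trans; apply.
by rewrite ler_wpM2r ?invr_ge0// ler_norm.
Qed.

Lemma normalized_sum_width (d : measure_display) (T : measurableType d) (n : nat)
    (U : T -> 'rV[R]_n) w : (0 < n)%N ->
  width (@cube R n) (U w) - Num.sqrt (2 * n%:R / pi) = normalized_sum U m w.
Proof.
move=> n0; have r0 : Num.sqrt n%:R != 0 :> R by rewrite gt_eqF// sqrtr_gt0 ltr0n.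
have r2 : n%:R = Num.sqrt n%:R ^+ 2 :> R by rewrite sqr_sqrtr ?ler0n.
rewrite width_cube /normalized_sum /coord_sum /scaled_coord.
under [in RHS]eq_bigr do rewrite /= normrM ger0_norm ?sqrtr_ge0//.
rewrite -mulr_sumr (_ : 2 * n%:R / pi = n%:R * (2 / pi)); last by rewrite -mulrA mulrCA.
rewrite sqrtrM ?ler0n// -/m.
move: (Num.sqrt n%:R) r0 r2 (\sum_i _) => r r0 -> S.
by field.
Qed.

Lemma mean_indic (d : measure_display) (T : measurableType d)
  (P : probability T R) (A : set T) : measurable A ->
  mean P (\1_A) = fine (P A).
Proof. by move=> mA; rewrite /mean /Rintegral integral_indic// setIT. Qed.

(** The indicator of []-oo, x]] lies between [ramp (x - e) e] and [ramp x e], and the limit law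
    gives these two ramps means within [e * normal_peak sigma] of its value on []-oo, x]]. *)
Lemma normalized_sum_cdf (dn : nat -> measure_display)
    (Tn : forall n, measurableType (dn n)) (P : forall n, probability (Tn n) R)
    (U : forall n, Tn n -> 'rV[R]_n) (x : R) :
  (forall n, (0 < n)%N -> uniform_on_sphere (P n) (U n)) ->
  (fun n => fine (P n [set w | normalized_sum (U n) m w <= x])) @ \oo -->
    normal_integral sigma (fun=> 1) x.
Proof.
move=> unif; apply/cvgrPdist_le => eps eps0.
have s0 := limit_std_gt0; have p0 : 0 < normal_peak sigma.
  by rewrite normal_peak_gt0// gt_eqF.
(* Smoothing then costs at most [eps / 2]; the other half is left to the Stein error. *)
pose e := eps / 2 / normal_peak sigma.
have e0 : 0 < e by rewrite !divr_gt0.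
have ep : e * normal_peak sigma = eps / 2 by rewrite divfK// gt_eqF.
have [C1 [C10 H1]] := mean_normalized_sum_cvg (@continuous_ramp R x e)
  (@ramp_ge0 R x e) (@ramp_le1 R x e).
have [C2 [C20 H2]] := mean_normalized_sum_cvg (@continuous_ramp R (x - e) e)
  (@ramp_ge0 R (x - e) e) (@ramp_le1 R (x - e) e).
have /andP[_ N1] := normal_mean_ramp x e0 sigma.
have /andP[N2 _] := normal_mean_ramp (x - e) e0 sigma.
have L1 := normal_integral_lipschitz x s0 (ltW e0).
have L2 := normal_integral_lipschitz (x - e) s0 (ltW e0).
rewrite subrK in L2.
near=> n.
have n0 : (0 < n)%N by near: n; exists 1%N.
have r0 : 0 < Num.sqrt n%:R :> R by rewrite sqrtr_gt0 ltr0n.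
have bW := bounded_rv_normalized_sum (unif n n0).
have B1 := H1 _ _ _ _ _ n0 (unif n n0).
have B2 := H2 _ _ _ _ _ n0 (unif n n0).
have small : (C1 + C2) / Num.sqrt n%:R <= eps / 2.
  rewrite ler_pdivrMr// -ler_pdivrMl ?divr_gt0//.
  rewrite -[leLHS]ger0_norm; last first.
    by rewrite mulr_ge0 ?addr_ge0// invr_ge0 divr_ge0// ltW.
  rewrite -sqrtr_sqr ler_wsqrtr//.
  by near: n; exact: nbhs_infty_ger.
have C1n : C1 / Num.sqrt n%:R <= eps / 2.
  apply: le_trans small; rewrite ler_wpM2r ?invr_ge0 ?sqrtr_ge0//.
  by rewrite lerDl.
have C2n : C2 / Num.sqrt n%:R <= eps / 2.
  apply: le_trans small; rewrite ler_wpM2r ?invr_ge0 ?sqrtr_ge0//.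
  by rewrite lerDr.
pose A := [set w | normalized_sum (U n) m w <= x].
have mA : measurable A := measurable_normalized_sum_le x (unif n n0).
have bA : bounded_rv (\1_A : Tn n -> R).
  split; first exact: measurable_indic.
  by exists 1 => w; rewrite indicE; case: (_ \in _); rewrite ?normr1 ?normr0.
have U1 : mean (P n) (\1_A) <= mean (P n) (fun w => ramp x e (normalized_sum (U n) m w)).
  apply: le_mean => //; first exact: bounded_rv_comp (@continuous_ramp R x e) bW.
  move=> w; rewrite indicE; case: (boolP (w \in A)); last by rewrite ramp_ge0.
  by rewrite inE /A/= => /(ramp_left e0) ->.
have U2 : mean (P n) (fun w => ramp (x - e) e (normalized_sum (U n) m w)) <= mean (P n) (\1_A).
  apply: le_mean => //; first exact: bounded_rv_comp (@continuous_ramp R (x - e) e) bW.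
  move=> w; rewrite indicE; case: (boolP (w \in A)); first by rewrite ramp_le1.
  rewrite notin_setE /A/= => /negP; rewrite -ltNge => /ltW xw.
  by rewrite ramp_right// subrK.
rewrite mean_indic// in U1 U2; rewrite -/A.
move: B1 B2; rewrite !ler_norml => /andP[_ B1] /andP[B2 _].
by apply/andP; split; lra.
Unshelve. all: by end_near. Qed.

End sphere_clt.

Theorem theorem3p2 (R : realType) (dn : nat -> measure_display)
  (Tn : forall n, measurableType (dn n)) (P : forall n, probability (Tn n) R)
  (U : forall n, Tn n -> 'rV[R]_n) :
  (forall n, (0 < n)%N -> uniform_on_sphere (P n) (U n)) ->
  cvg_in_distribution P
    (fun n w => width (@cube R n) (U n w) - Num.sqrt (2 * n%:R / pi))
    (normal_prob 0 (Num.sqrt ((pi - 3) / pi))).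
Proof.
move=> unif x _.
have E n : (0 < n)%N ->
    [set w | width (@cube R n) (U n w) - Num.sqrt (2 * n%:R / pi) <= x] =
    [set w | normalized_sum (U n) (@abs_normal_mean R) w <= x].
  by move=> n0; apply/seteqP; split => w /=; rewrite normalized_sum_width.
have -> : normal_prob 0 (Num.sqrt ((pi - 3) / pi)) [set` `]-oo, x]] =
    (normal_integral (Num.sqrt ((pi - 3) / pi)) (fun=> 1) x)%:E.
  by rewrite normal_integralE fineK// fin_num_measure.
apply/fine_cvgP; split.
  (* Dimension [0], where the sphere is empty, is discarded by the limit. *)
  near=> n; have n0 : (0 < n)%N by near: n; exists 1%N.
  rewrite E// fin_num_measure//; exact: measurable_normalized_sum_le (unif n n0).
apply: cvg_trans (normalized_sum_cdf (x := x) unif).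
apply: near_eq_cvg; near=> n.
by rewrite /= E//; near: n; exists 1%N.
Unshelve. all: by end_near. Qed.
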